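(* Let $P\subseteq\mathbb{R}^d$ be a full-dimensional polytope with $T_P\subseteq I_P$, let $p$ be a vertex of $P$, and suppose $P$ is not (combinatorially) the vertex sum at $p$ of two polytopes each of positive dimension. Then the vertex split $P_p$ satisfies $T_{P_p}\subseteq I_{P_p}$. In particular, if $P$ is graphic and is not such a vertex sum at $p$, then $P_p$ is graphic.
   Context: Vertex split: $P_p=\mathrm{conv}(\{(w,0): w \text{ a vertex of } P,\ w\neq p\}\cup\{(p,1),(p,-1)\})\subseteq\mathbb{R}^{d+1}$. Vertex sum at $p$: for $Q$ of dimension $a$ with vertex $v$ and $R$ of dimension $b$ with vertex $w$, embed them in $\mathbb{R}^{a+b}$ with affine spans meeting in a single point $p$ that is the image of both $v$ and $w$; $Q\oplus_p R$ is the convex hull of the union. For a $D$-polytope $S$ with facets $F_i$ (given by affine $h_i\ge0$ vanishing on $F_i$) and vertices $v_j$, the symbolic slack matrix replaces each nonzero entry of $[h_i(v_j)]$ by a distinct variable; $I_S$ is the ideal of its $(D+2)$-minors saturated by the product of all variables. The non-incidence graph $\mathbf G_S$ is bipartite on facets $\sqcup$ vertices, edge $\{F,v\}$ iff $v\notin F$, labeled by the variable at $(F,v)$. For a directed cycle $C$, $f_C$ = (product of labels of edges directed facet$\to$vertex) $-$ (product of labels of edges directed vertex$\to$facet). $T_S$ is generated by $f_C$ over chordless cycles of $\mathbf G_S$. $S$ is graphic if $I_S=T_S$. *)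

(* Defs.v *)
From HB Require Import structures.
From mathcomp Require Import all_boot all_order all_algebra.
From mathcomp Require Import finmap.
From mathcomp Require Import boolp classical_sets functions cardinality reals.
From mathcomp Require Import mpoly.

Set Implicit Arguments.
Unset Strict Implicit.
Unset Printing Implicit Defensive.

Import Order.TTheory GRing.Theory Num.Theory.
Local Open Scope classical_set_scope.
Local Open Scope ring_scope.

Section Polytopes.
Context {R : realType}.
Implicit Types d : nat.

Definition conv d (A : set 'rV[R]_d) : set 'rV[R]_d :=
  [set x | exists (n : nat) (y : 'I_n -> 'rV[R]_d) (c : 'I_n -> R),
     [/\ forall i, A (y i), forall i, 0 <= c i, \sum_i c i = 1
       & x = \sum_i c i *: y i]].

Definition aff d (A : set 'rV[R]_d) : set 'rV[R]_d :=
  [set x | exists (n : nat) (y : 'I_n -> 'rV[R]_d) (c : 'I_n -> R),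
     [/\ forall i, A (y i), \sum_i c i = 1 & x = \sum_i c i *: y i]].

Definition affinely_independent d n (y : 'I_n -> 'rV[R]_d) : Prop :=
  forall c : 'I_n -> R,
    \sum_i c i = 0 -> \sum_i c i *: y i = 0 -> forall i, c i = 0.

(* The affine dimension plus one, so that the empty set gets 0; affinely
   independent families in R^d have at most d + 1 members. *)
Definition adim1 d (A : set 'rV[R]_d) : nat :=
  (\max_(n < d.+2 | `[< exists y : 'I_n -> 'rV[R]_d,
      (forall i, A (y i)) /\ affinely_independent y >]) n)%N.

Definition polytope d (P : set 'rV[R]_d) : Prop :=
  exists s : seq 'rV[R]_d, P = conv [set` s].

Definition full_dimensional d (P : set 'rV[R]_d) : Prop := adim1 P = d.+1.

(* The pair (a, b) stands for the affine function x |-> <x, a> + b. *)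
Definition affine_eval d (h : 'cV[R]_d * R) (x : 'rV[R]_d) : R :=
  (x *m h.1) 0 0 + h.2.

Definition cuts_face d (P : set 'rV[R]_d) (h : 'cV[R]_d * R)
    (F : set 'rV[R]_d) : Prop :=
  (forall x, P x -> 0 <= affine_eval h x) /\
  F = P `&` [set x | affine_eval h x = 0].

(* The empty set and P itself are (improper) faces of P. *)
Definition face d (P : set 'rV[R]_d) : set (set 'rV[R]_d) :=
  [set F | exists h, cuts_face P h F].

Definition vertex d (P : set 'rV[R]_d) : set 'rV[R]_d :=
  [set x | face P [set x]].

Definition facet d (P : set 'rV[R]_d) : set (set 'rV[R]_d) :=
  [set F | face P F /\ (adim1 F).+1 = adim1 P].

(* Isomorphism of face lattices matching the vertex p with the vertex q. *)
Definition comb_equiv_at d e (P : set 'rV[R]_d) (p : 'rV[R]_d)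
    (Q : set 'rV[R]_e) (q : 'rV[R]_e) : Prop :=
  exists f : set 'rV[R]_d -> set 'rV[R]_e,
    [/\ set_bij (face P) (face Q) f,
        forall F G, face P F -> face P G -> (F `<=` G <-> f F `<=` f G)
      & f [set p] = [set q]].

Definition vertex_split d (P : set 'rV[R]_d) (p : 'rV[R]_d) :
    set 'rV[R]_(d + 1) :=
  conv ([set row_mx w 0 | w in vertex P `\ p] `|`
        [set row_mx p (const_mx 1); row_mx p (const_mx (-1))]).

Definition is_vertex_sum a b (Q : set 'rV[R]_a) (v : 'rV[R]_a)
    (T : set 'rV[R]_b) (w : 'rV[R]_b)
    (S : set 'rV[R]_(a + b)) (s : 'rV[R]_(a + b)) : Prop :=
  exists (A : 'M[R]_(a, a + b)) (t : 'rV[R]_(a + b))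
         (B : 'M[R]_(b, a + b)) (u : 'rV[R]_(a + b)),
    let f := fun x : 'rV[R]_a => x *m A + t in
    let g := fun x : 'rV[R]_b => x *m B + u in
    [/\ row_free A /\ row_free B,
        f v = s /\ g w = s,
        aff (f @` Q) `&` aff (g @` T) = [set s]
      & S = conv (f @` Q `|` g @` T)].

Definition comb_vertex_sum_at d (P : set 'rV[R]_d) (p : 'rV[R]_d) : Prop :=
  exists (a b : nat) (Q : set 'rV[R]_a) (v : 'rV[R]_a)
         (T : set 'rV[R]_b) (w : 'rV[R]_b)
         (S : set 'rV[R]_(a + b)) (s : 'rV[R]_(a + b)),
    [/\ (0 < a)%N /\ (0 < b)%N,
        [/\ polytope Q, full_dimensional Q & vertex Q v],
        [/\ polytope T, full_dimensional T & vertex T w],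
        is_vertex_sum Q v T w S s
      & comb_equiv_at P p S s].

End Polytopes.

Section Ideals.
Context {A : comNzRingType}.

Definition ideal_gen (G : set A) : set A :=
  [set f | exists (n : nat) (c g : 'I_n -> A),
     (forall i, G (g i)) /\ f = \sum_i c i * g i].

Definition saturation (I : set A) (g : A) : set A :=
  [set f | exists k : nat, I (g ^+ k * f)].

Definition minors (X Y : Type) (M : X -> Y -> A) (n : nat) : set A :=
  [set f | exists (r : 'I_n -> X) (c : 'I_n -> Y),
     [/\ injective r, injective c
       & f = \det (\matrix_(i < n, j < n) M (r i) (c j))]].

End Ideals.

(* Directed cycles of length at least 3, as cyclic sequences of distinct
   vertices; the arcs are x -> next c x. *)
Definition chordless_cycle (T : eqType) (e : rel T) (c : seq T) : Prop :=
  [/\ (2 < size c)%N, ucycle e c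
    & forall x y, x \in c -> y \in c -> e x y ->
        y = next c x \/ x = next c y].

Section SlackIdeal.
Context {R : realType} (K : fieldType) {d : nat} (S : set 'rV[R]_d).

Definition facetT : finType := fset_set (facet S).
Definition vertexT : finType := fset_set (vertex S).

Definition facet_ineq (F : set 'rV[R]_d) : 'cV[R]_d * R :=
  xget (0, 0) [set h | cuts_face S h F].

Definition slack (F : facetT) (v : vertexT) : R :=
  affine_eval (facet_ineq (val F)) (val v).

Definition slack_support : finType :=
  {e : facetT * vertexT | slack e.1 e.2 != 0}.

Definition slack_ring := {mpoly K[#|slack_support|]}.

Definition symbolic_slack (F : facetT) (v : vertexT) : slack_ring :=
  if insub (F, v) is Some e then 'X_(enum_rank (e : slack_support)) else 0.

Definition slack_ideal : set slack_ring :=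
  saturation (ideal_gen (minors symbolic_slack (adim1 S).+1))
             (\prod_(i < #|slack_support|) 'X_i).

Definition nonincidence : rel (facetT + vertexT) := fun x y =>
  match x, y with
  | inl F, inr v | inr v, inl F => val v \notin val F
  | _, _ => false
  end.

(* The label of the arc x -> y if it goes from a facet to a vertex, else 1. *)
Definition arc_label (x y : facetT + vertexT) : slack_ring :=
  if (x, y) is (inl F, inr v) then symbolic_slack F v else 1.

Definition cycle_binomial (c : seq (facetT + vertexT)) : slack_ring :=
  \prod_(x <- c) arc_label x (next c x) - \prod_(x <- c) arc_label (next c x) x.

Definition toric_ideal : set slack_ring :=
  ideal_gen [set cycle_binomial c | c in chordless_cycle nonincidence].

Definition graphic : Prop := slack_ideal = toric_ideal.

End SlackIdeal.

Arguments slack_ideal {R} K {d} S.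
Arguments toric_ideal {R} K {d} S.
Arguments graphic {R} K {d} S.

(* Main.v *)
(** Since [I_S] is saturated, the binomial of a directed cycle lies in it iff the
    labels along the two directions of the cycle have the same product modulo
    [I_S]. A chord splits a cycle in two, so if this holds for chordless cycles
    it holds for all closed walks.
    The facets of [P_p] are one facet over each facet of [P] through [p] and two
    over each other facet, so the non-incidence graph of [P_p] consists of two
    copies of that of [P], one for each copy of [p], glued along the subgraph of
    the facets through [p] and the vertices other than [p]. Minors of [P] map to
    minors of [P_p] after bordering by the column of the other copy of [p], so
    the closed walks inside each copy are balanced. If the common subgraph is
    connected, any closed walk is cut into walks inside one copy. If it is
    disconnected, the two parts of its vertex set span complementary subspaces
    through [p], because the normals of the facets through [p] span the dual
    space; then [P] itself is a vertex sum at [p].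
    For graphicality, evaluating at the all-ones point shows that the 0/1
    non-incidence matrix of [P] has rank at most [d + 1]; that of [P_p] has rank
    at most one more, so [I_(P_p)] lies in the kernel of [x_(F,v) |-> s_F t_v].
    This kernel is [T_(P_p)]: two monomials with the same image differ by a
    permutation, whose cycles are closed walks. *)

Require Import Defs.
From HB Require Import structures.
From mathcomp Require Import all_fingroup all_boot all_order all_algebra.
From mathcomp Require Import finmap.
From mathcomp Require Import boolp classical_sets functions cardinality reals.
From mathcomp Require Import mpoly.
From mathcomp Require Import ring lra zify.

Local Open Scope classical_set_scope.

Set Implicit Arguments.
Unset Strict Implicit.
Unset Printing Implicit Defensive.

Import Order.TTheory GRing.Theory Num.Theory.
Local Open Scope ring_scope.

(** * Ideals and closed walks *)

(** Only the zero pattern of the slack matrix matters, so the algebra is done for arbitrary finite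
    bipartite patterns over an arbitrary field. Geometry supplies the facets and vertices of the
    split, the connectedness of the common subgraph, and a facet avoiding [p]: its row makes the
    corner of a bordered minor a variable, which the saturated ideal cancels.

    Reduction to chordless cycles needs no cancellation, since an edge carries a variable in one
    direction only; it therefore also holds inside [T] itself, where the permutation argument uses
    it. Cancellation is needed for gluing: a walk crossing between the copies is closed up by a
    detour in the common subgraph, whose labels must be removed afterwards.

    A facet of the split contains a copy of [p]: otherwise it would lie at height 0, a hyperplane
    with the two copies of [p] strictly on opposite sides. Vanishing at that copy fixes the slope of
    its functional in the new coordinate, so the facet is determined by a facet of [P] and a sign,
    and the sign is immaterial when the functional vanishes at [p].

    That facet normals span is derived from convex hulls alone: the Farkas lemma gives the vertices,
    and a pencil argument gives [facet_span]. *)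

Section IdealTheory.
Context {A : comNzRingType}.
Implicit Types (I G : set A).

Definition is_ideal I :=
  [/\ I 0, forall x y, I x -> I y -> I (x + y) & forall a x, I x -> I (a * x)].

Lemma ideal_sum I (T : Type) (s : seq T) (P : pred T) (f : T -> A) :
  is_ideal I -> (forall i, P i -> I (f i)) -> I (\sum_(i <- s | P i) f i).
Proof. by move=> [I0 D _] If; apply: big_ind. Qed.

Lemma ideal_gen_ideal G : is_ideal (ideal_gen G).
Proof.
split.
- exists 0%N, (fun=> 0), (fun=> 0); split; first by case.
  by rewrite big_ord0.
- move=> _ _ [n [c [g [Gg ->]]]] [m [c' [g' [Gg' ->]]]].
  exists (n + m)%N.
  exists (fun i => match fintype.split i with inl i => c i | inr i => c' i end).
  exists (fun i => match fintype.split i with inl i => g i | inr i => g' i end).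
  split; first by move=> i; case: fintype.split.
  rewrite big_split_ord /=; congr (_ + _); apply: eq_bigr => i _.
    by rewrite -[lshift m i]/(unsplit (inl i)) unsplitK.
  by rewrite -[rshift n i]/(unsplit (inr i)) unsplitK.
- move=> a _ [n [c [g [Gg ->]]]]; exists n, (fun i => a * c i), g; split=> //.
  by rewrite mulr_sumr; apply: eq_bigr => i _; rewrite mulrA.
Qed.

Lemma ideal_gen_sub G I : is_ideal I -> G `<=` I -> ideal_gen G `<=` I.
Proof.
move=> idI GI _ [n [c [g [Gg ->]]]]; apply: ideal_sum => // i _.
by case: idI => _ _; apply; apply: GI.
Qed.

Lemma sub_ideal_gen G : G `<=` ideal_gen G.
Proof.
move=> x Gx; exists 1%N, (fun=> 1), (fun=> x); split=> //.
by rewrite big_ord1 mul1r.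
Qed.

Lemma saturation_ideal I g : is_ideal I -> is_ideal (saturation I g).
Proof.
move=> [I0 D M]; split.
- by exists 0%N; rewrite mulr0.
- move=> x y [k Ix] [l Iy]; exists (k + l)%N.
  have -> : g ^+ (k + l) * (x + y) = g ^+ l * (g ^+ k * x) + g ^+ k * (g ^+ l * y).
    by rewrite exprD; ring.
  by apply: D; apply: M.
- by move=> a x [k Ix]; exists k; rewrite mulrCA; apply: M.
Qed.

(** One further power of [g] supplies the cofactor [b] together with the missing factor [a]. *)
Lemma saturation_cancel I g a b x :
  is_ideal I -> g = a * b -> saturation I g (a * x) -> saturation I g x.
Proof.
move=> [_ _ M] gE [k Ik]; exists k.+1.
have -> : g ^+ k.+1 * x = b * (g ^+ k * (a * x)) by rewrite exprS {1}gE; ring.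
exact: M.
Qed.

Lemma sub_saturation I g : I `<=` saturation I g.
Proof. by move=> x Ix; exists 0%N; rewrite expr0 mul1r. Qed.

Lemma det_eq0_noninj n (M : 'I_n -> 'I_n -> A) :
  (exists i j, i != j /\ forall k, M i k = M j k) ->
  \det (\matrix_(i, j) M i j) = 0.
Proof.
move=> [i [j [ij Mij]]]; apply: (determinant_alternate ij) => k.
by rewrite !mxE.
Qed.

(** A repeated row or column makes the determinant zero, so the injectivity demanded by [minors]
    need not be checked when rows and columns are lifted or bordered. *)
Lemma ideal_minors (X Y : Type) (M : X -> Y -> A) n (r : 'I_n -> X)
    (c : 'I_n -> Y) :
  ideal_gen (minors M n) (\det (\matrix_(i, j) M (r i) (c j))).
Proof.
have [I0 _ _] := ideal_gen_ideal (minors M n).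
have [ri|rn] := pselect (injective r); last first.
  suff -> : \det (\matrix_(i, j) M (r i) (c j)) = 0 by [].
  apply: contrapT => dn0; apply: rn => i j rij; apply: contrapT => ij.
  apply: dn0; apply: (@det_eq0_noninj _ (fun i j => M (r i) (c j))).
  by exists i, j; rewrite rij; split=> //; apply/eqP.
have [ci|cn] := pselect (injective c); last first.
  suff -> : \det (\matrix_(i, j) M (r i) (c j)) = 0 by [].
  apply: contrapT => dn0; apply: cn => i j cij; apply: contrapT => ij.
  apply: dn0; rewrite -det_tr.
  have -> : (\matrix_(i, j) M (r i) (c j))^T = \matrix_(i, j) M (r j) (c i).
    by apply/matrixP => k l; rewrite !mxE.
  apply: (@det_eq0_noninj _ (fun i j => M (r j) (c i))).
  by exists i, j; rewrite cij; split=> //; apply/eqP.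
by apply: sub_ideal_gen; exists r, c.
Qed.

End IdealTheory.

(** * Products of labels along walks *)

Section Walks.
Context {A : comNzRingType} {T : eqType}.
Implicit Types (f : T -> T -> A) (x y : T) (p q c : seq T).

Definition walk_prod f x p : A := \prod_(a <- pairmap f x p) a.

(** Closed walks may repeat nodes, and [next] is ambiguous there; consecutive entries are multiplied
    instead. For duplicate-free cycles [cycle_prod_next] restores the form used in the cycle
    binomials. *)
Definition cycle_prod f c : A :=
  if c is x :: p then walk_prod f x (rcons p x) else 1.

Definition opp_label f x y := f y x.

Lemma walk_prod_nil f x : walk_prod f x [::] = 1.
Proof. by rewrite /walk_prod big_nil. Qed.

Lemma walk_prod_cons f x y p : walk_prod f x (y :: p) = f x y * walk_prod f y p.
Proof. by rewrite /walk_prod big_cons. Qed.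

Lemma walk_prod_cat f x p q :
  walk_prod f x (p ++ q) = walk_prod f x p * walk_prod f (last x p) q.
Proof. by rewrite /walk_prod pairmap_cat big_cat. Qed.

Lemma walk_prod_rcons f x p y :
  walk_prod f x (rcons p y) = walk_prod f x p * f (last x p) y.
Proof. by rewrite -cats1 walk_prod_cat walk_prod_cons walk_prod_nil mulr1. Qed.

Lemma walk_prod_rev f x p :
  walk_prod f (last x p) (rev (belast x p)) = walk_prod (opp_label f) x p.
Proof.
elim: p x => [|y p IH] x; first by rewrite !walk_prod_nil.
rewrite /= rev_cons walk_prod_rcons IH walk_prod_cons mulrC; congr (f _ _ * _).
by case: p {IH} => //= z p; rewrite rev_cons last_rcons.
Qed.

Lemma cycle_prod_cat f c c' : cycle_prod f (c ++ c') = cycle_prod f (c' ++ c).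
Proof.
case: c c' => [|x p] [|y q]; rewrite ?cats0 //= !rcons_cat /= !walk_prod_cat.
by rewrite !walk_prod_cons !walk_prod_rcons; ring.
Qed.

Lemma cycle_prod_rot f n c : cycle_prod f (rot n c) = cycle_prod f c.
Proof. by rewrite /rot cycle_prod_cat cat_take_drop. Qed.

Lemma cycle_prod_next f c : uniq c ->
  cycle_prod f c = \prod_(x <- c) f x (next c x).
Proof.
case: c => [|x p]; first by rewrite big_nil.
move=> Up; rewrite /cycle_prod /walk_prod.
rewrite (big_nth 1) size_pairmap size_rcons (big_nth x) [size (x :: p)]/=.
apply: eq_big_nat => i /andP[_ ip].
rewrite (nth_pairmap x) ?size_rcons // -rcons_cons nth_rcons ip.
rewrite next_nth mem_nth // index_uniq //; congr (f _ _).
by rewrite nth_rcons; case: ltnP => // pi; rewrite nth_default //; case: eqP.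
Qed.

Section Balanced.
Variables (I : set A) (e : rel T) (a : T -> T -> A).
Hypothesis idI : is_ideal I.
Hypothesis e_sym : ssrbool.symmetric e.
Hypothesis e_irr : irreflexive e.
Hypothesis a_one : forall x y, e x y -> a x y = 1 \/ a y x = 1.

Definition balanced c : Prop := I (cycle_prod a c - cycle_prod (opp_label a) c).

Lemma balanced_rot n c : balanced (rot n c) -> balanced c.
Proof. by rewrite /balanced !cycle_prod_rot. Qed.

Lemma balanced_split x p q : balanced (x :: p) -> balanced (x :: q) ->
  balanced (x :: p ++ x :: q).
Proof.
case: idI => _ D M Ip Iq; rewrite /balanced /= !rcons_cat /=.
rewrite -!cat_rcons !walk_prod_cat !last_rcons.
move: Ip Iq; rewrite /balanced /=.
set o1 := walk_prod a _ _; set i1 := walk_prod _ _ _.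
set o2 := walk_prod a _ _; set i2 := walk_prod _ _ _ => Ip Iq.
have -> : o1 * o2 - i1 * i2 = o1 * (o2 - i2) + i2 * (o1 - i1) by ring.
by apply: D; apply: M.
Qed.

(* The chord carries a variable in one of its two directions only, so the two
   shorter cycles combine without dividing by its label. *)
Lemma balanced_chord x p y q : e x y ->
  balanced (x :: rcons p y) -> balanced (y :: rcons q x) ->
  balanced (x :: p ++ y :: q).
Proof.
case: idI => _ D M exy; rewrite /balanced /= !rcons_cat /=.
rewrite -cat_rcons !walk_prod_cat !last_rcons.
rewrite !(walk_prod_rcons _ _ (rcons _ _)) !last_rcons /opp_label /=.
set o1 := walk_prod a _ _; set i1 := walk_prod _ _ _.
set o2 := walk_prod a _ _; set i2 := walk_prod _ _ _ => Ip Iq.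
have [a1|a1] := a_one exy; rewrite a1 !mulr1 in Ip Iq.
  have -> : o1 * o2 - i1 * i2 =
    o1 * (o2 - i2 * a y x) + i2 * (o1 * a y x - i1) by ring.
  by apply: D; apply: M.
have -> : o1 * o2 - i1 * i2 =
  o2 * (o1 - i1 * a x y) + i1 * (o2 * a x y - i2) by ring.
by apply: D; apply: M.
Qed.

Lemma not_uniq_split c : ~~ uniq c ->
  exists s x p q, c = s ++ x :: p ++ x :: q.
Proof.
elim: c => //= x c IH; rewrite negb_and negbK => /orP[xc|/IH].
  by case/splitPr: xc => p q; exists [::], x, p, q.
by move=> [s [y [p [q ->]]]]; exists (x :: s), y, p, q.
Qed.

(** Strong induction on the length: a repeated node or a chord cuts a closed walk into two shorter
    ones. Nothing is cancelled, so [I] need not be saturated. *)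
Lemma cycle_balanced :
  (forall c, chordless_cycle e c -> balanced c) ->
  forall c, cycle e c -> balanced c.
Proof.
move=> Hchordless c; have [n] := ubnP (size c); elim: n c => // n IH c cn ec.
have I0 : I 0 by case: idI.
have [Uc|] := boolP (uniq c); last first.
  move=> /not_uniq_split[s [x [p [q cE]]]].
  apply: (@balanced_rot (size s)); move: cn ec.
  rewrite -(rot_cycle (size s)) -(size_rot (size s)) cE rot_size_cat -/cat.
  rewrite !cat_cons -catA cat_cons => cn ec.
  have := ec; rewrite /= rcons_cat /= -cat_rcons cat_path last_rcons.
  move=> /andP[ep eq]; move: cn; rewrite /= size_cat /= => cn.
  apply: balanced_split; apply: IH => //=; lia.
(* A closed walk of length two runs through one edge back and forth, so both products agree by
   commutativity. *)
have [c2|c2] := leqP (size c) 2.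
  move: c2 {cn ec IH Uc}; rewrite /balanced; case: c => [|x [|y []]] //= _.
  - by rewrite subrr.
  - by rewrite !walk_prod_cons !walk_prod_nil subrr.
  - rewrite !walk_prod_cons !walk_prod_nil /opp_label.
    by rewrite !mulr1 mulrC subrr.
have [H|] := pselect (chordless_cycle e c); first exact: Hchordless.
rewrite /chordless_cycle => Hc.
have [x [y [xc yc exy yx xy]]] : exists x y,
    [/\ x \in c, y \in c, e x y, y != next c x & x != next c y].
  apply: contrapT => N; apply: Hc; split=> //; first by apply/andP.
  move=> x y xc yc exy; have [|yx] := eqVneq y (next c x); first by left.
  have [|xy] := eqVneq x (next c y); first by right.
  by case: N; exists x, y.
have [i p cE] := rot_to xc.
have yNx : y != x by apply: contraTneq exy => ->; rewrite e_irr.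
apply: (@balanced_rot i); move: cn ec yc yx xy.
rewrite -(next_rot i Uc x) -(next_rot i Uc y) -(rot_cycle i) -(size_rot i).
rewrite -(mem_rot i); move: Uc; rewrite -(rot_uniq i) cE => Uc cn ec.
rewrite in_cons (negPf yNx) /= => yp.
move: cn ec Uc; case/splitPr: yp => p1 p2 cn ec Uc yx xy.
(* As [x] and [y] are not consecutive, both arcs between them have inner nodes; each of the two
   cycles through the chord is then strictly shorter. *)
have p1n : p1 != [::] by apply: contraNneq yx => ->; rewrite /= eqxx.
have p2n : p2 != [::].
  apply: contraNneq xy => p20; rewrite p20 in Uc *.
  have := next_rot (size (x :: p1)) Uc y.
  by rewrite -cat_cons rot_size_cat /= eqxx => <-.
move: ec; rewrite /= rcons_cat /= -cat_rcons cat_path last_rcons.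
move: cn; rewrite /= size_cat /= => cn /andP[ep1 ep2].
apply: balanced_chord => //; apply: IH.
- by move: p2n cn; case: (p2) => //= z p3 _; rewrite size_rcons; lia.
- by rewrite /= rcons_path last_rcons ep1 e_sym.
- by move: p1n cn; case: (p1) => //= z p3 _; rewrite size_rcons; lia.
- by rewrite /= rcons_path last_rcons ep2 exy.
Qed.

Lemma cycle_prod_belast f x p : last x p = x ->
  cycle_prod f (belast x p) = walk_prod f x p.
Proof.
case: p => [|y p] xl; first by rewrite walk_prod_nil.
by rewrite /= -{2}xl /= -lastI.
Qed.

(** Following [p] and then [q] backwards gives a closed walk, and reversal exchanges the labels of
    the two directions. The predicate [V] lets this be used when only the closed walks inside one
    copy are known to be balanced. *)
Lemma walks_balanced (V : pred T) x p q :
  (forall c, path.cycle e c -> all V c -> balanced c) ->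
  path e x p -> path e x q -> all V (x :: p) -> all V q ->
  last x p = last x q ->
  I (walk_prod a x p * walk_prod (opp_label a) x q -
     walk_prod (opp_label a) x p * walk_prod a x q).
Proof.
move=> HV ep eq Vp Vq pq.
set w := p ++ rev (belast x q).
have xw : last x w = x.
  by rewrite last_cat pq; case: (q) => //= y s; rewrite rev_cons last_rcons.
have ew : path e x w.
  rewrite cat_path ep pq rev_path /=.
  by rewrite (@eq_path _ (fun z => e^~ z) e) // => y z; apply: e_sym.
have -> : walk_prod a x p * walk_prod (opp_label a) x q = walk_prod a x w.
  by rewrite walk_prod_cat pq walk_prod_rev.
have -> : walk_prod (opp_label a) x p * walk_prod a x q =
          walk_prod (opp_label a) x w.
  by rewrite walk_prod_cat pq walk_prod_rev.
rewrite -!cycle_prod_belast //; apply: HV.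
  case: (w) xw ew => // y s xs eys; rewrite /= -{2}xs /= -lastI.
  exact: eys.
have : all V (x :: w).
  rewrite /w -cat_cons all_cat Vp all_rev /=.
  have : all V (x :: q) by case/andP: Vp => Vx _; rewrite /= Vx.
  by rewrite lastI all_rcons => /andP[].
by rewrite lastI all_rcons => /andP[].
Qed.

Lemma walk_prod_cancel x p z :
  (forall x y z, e x y -> I (a x y * z) -> I z) ->
  path e x p -> I (walk_prod a x p * z) -> I z.
Proof.
move=> H; elim: p x => [|y p IH] x /=; first by rewrite walk_prod_nil mul1r.
move=> /andP[exy ep]; rewrite walk_prod_cons -mulrA => /(H _ _ _ exy).
exact: IH.
Qed.

Lemma opp_walk_prod_cancel x p z :
  (forall x y z, e x y -> I (a x y * z) -> I z) ->
  path e x p -> I (walk_prod (opp_label a) x p * z) -> I z.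
Proof.
move=> H; elim: p x => [|y p IH] x /=; first by rewrite walk_prod_nil mul1r.
move=> /andP[exy ep]; rewrite walk_prod_cons -mulrA.
by move=> /(H y x) Iz; apply: IH ep (Iz _); rewrite e_sym.
Qed.

(** * Gluing two graphs along a connected overlap *)

Section Gluing.
Variables V1 V2 : pred T.
Hypothesis V12 : forall x, V1 x || V2 x.
Hypothesis eV12 : forall x y, e x y -> V1 x && V1 y || V2 x && V2 y.
Hypothesis a_cancel : forall x y z, e x y -> I (a x y * z) -> I z.
Hypothesis bal1 : forall c, path.cycle e c -> all V1 c -> balanced c.
Hypothesis bal2 : forall c, path.cycle e c -> all V2 c -> balanced c.

Let V0 x := V1 x && V2 x.

Hypothesis V0_conn : forall x y, V0 x -> V0 y ->
  exists p, [/\ path e x p, all V0 p & last x p = y].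

(* A walk meeting the overlap only at its ends stays on one side of it. *)
Lemma path_one_side x p : path e x p -> ~~ has V0 p ->
  V1 x && all V1 p || V2 x && all V2 p.
Proof.
elim: p x => [|y p IH] x; first by rewrite /= !andbT.
rewrite /= negb_or => /andP[exy ep] /andP[V0y np].
have := IH _ ep np; have := eV12 exy; move: V0y; rewrite /V0.
by case: (V1 x); case: (V1 y); case: (V2 x); case: (V2 y); case: all; case: all.
Qed.

(** Induction on the length of [p], cut at its first return [y] to the overlap. A walk [r] inside
    the overlap leads from [y] to the end of [p]. The initial part followed by [r] stays, like [q],
    on one side; the rest of [p] is shorter and is compared with [r]. Combining the two comparisons
    proves the claim multiplied by the products of [r] in both directions, which are then
    cancelled. *)
Lemma glued_walks_balanced x p q : V0 x -> V0 (last x p) ->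
  path e x p -> path e x q -> all V0 q -> last x q = last x p ->
  I (walk_prod a x p * walk_prod (opp_label a) x q -
     walk_prod (opp_label a) x p * walk_prod a x q).
Proof.
have V01 s : all V0 s -> all V1 s by apply: sub_all => z /andP[].
have V02 s : all V0 s -> all V2 s by apply: sub_all => z /andP[].
have [n] := ubnP (size p); elim: n x p q => // n IH x p q pn V0x V0p ep eq Vq pq.
have [p0|pN] := eqVneq p [::].
  move: ep pq; rewrite p0 => ep pq.
  apply: (walks_balanced bal1) => //; last exact: V01.
  by rewrite /= andbT; case/andP: V0x.
have V0hp : has V0 p.
  apply/hasP; exists (last x p) => //.
  by case: (p) pN => //= y s _; apply: mem_last.
case: (split_find V0hp) pn ep V0p pq pN => {p V0hp} y u v V0y nu pn ep V0p pq _.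
move: ep V0p pq pn; rewrite cat_path !last_cat last_rcons.
move=> /andP[eu ev] V0p pq; rewrite size_cat size_rcons => pn.
have [r [er Vr ry]] := V0_conn V0y V0p.
have Iv : I (walk_prod a y v * walk_prod (opp_label a) y r -
             walk_prod (opp_label a) y v * walk_prod a y r).
  by apply: IH => //; lia.
have Iu : I (walk_prod a x (rcons u y ++ r) * walk_prod (opp_label a) x q -
             walk_prod (opp_label a) x (rcons u y ++ r) * walk_prod a x q).
  have ew : path e x (rcons u y ++ r) by rewrite cat_path eu last_rcons.
  have wq : last x (rcons u y ++ r) = last x q.
    by rewrite last_cat last_rcons ry pq.
  move: eu; rewrite rcons_path => /andP[eu _].
  case/andP: V0x => V1x V2x; case/andP: V0y => V1y V2y.
  have /orP[/andP[_ Vu]|/andP[_ Vu]] := path_one_side eu nu.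
    apply: (walks_balanced bal1) => //; last exact: V01.
    by rewrite /= V1x all_cat all_rcons V1y Vu V01.
  apply: (walks_balanced bal2) => //; last exact: V02.
  by rewrite /= V2x all_cat all_rcons V2y Vu V02.
case: idI => _ D M; rewrite !walk_prod_cat !last_rcons.
apply: (walk_prod_cancel a_cancel er); apply: (opp_walk_prod_cancel a_cancel er).
move: Iu Iv; rewrite !walk_prod_cat !last_rcons.
set o1 := walk_prod a x _; set o2 := walk_prod a y v; set o3 := walk_prod a y r.
set o4 := walk_prod a x q; set i4 := walk_prod _ x q.
set i1 := walk_prod _ x _; set i2 := walk_prod _ y v.
set i3 := walk_prod _ y r => Iu Iv.
have -> : i3 * (o3 * (o1 * o2 * i4 - i1 * i2 * o4)) =
   o3 * i4 * o1 * (o2 * i3 - i2 * o3) + i2 * o3 * (o1 * o3 * i4 - i1 * i3 * o4).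
  by ring.
by apply: D; apply: M.
Qed.

(** A closed walk meeting the overlap is rotated to start there and compared with the empty walk;
    any other stays on one side. *)
Lemma glued_cycle_balanced c : path.cycle e c -> balanced c.
Proof.
move=> ec; case: (boolP (has V0 c)) => [/hasP[x xc V0x]|nc].
  have [i p cE] := rot_to xc; apply: (@balanced_rot i).
  move: ec; rewrite -(rot_cycle i) cE /= => ep.
  have := @glued_walks_balanced x (rcons p x) [::].
  rewrite !walk_prod_nil !mulr1 last_rcons /balanced /=; exact.
case: c ec nc => [|x p]; first by rewrite /balanced subrr; case: idI.
move=> ec; have := ec; rewrite /= rcons_path => /andP[ep _].
rewrite negb_or => /andP[_ np].
by have /orP[Vp|Vp] := path_one_side ep np; [apply: bal1|apply: bal2].
Qed.

End Gluing.
End Balanced.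
End Walks.

(** * Toric ideal of an incidence pattern *)

Lemma perm_eq_map_lift (S T : eqType) (f : S -> T) (s : seq S) (t : seq T) :
  perm_eq (map f s) t -> exists2 s', perm_eq s s' & map f s' = t.
Proof.
case: s => [|x0 s] st.
  by exists [::] => //; apply/esym/perm_nilP; rewrite perm_sym.
rewrite perm_sym in st; have [js jsP ->] := perm_iotaP (f x0) st.
rewrite size_map in jsP.
exists (map (nth x0 (x0 :: s)) js).
  by rewrite perm_sym; apply/(perm_iotaP x0); exists js.
rewrite -map_comp; apply/eq_in_map => i; rewrite (perm_mem jsP) mem_iota.
by move=> /andP[_ isz]; rewrite [LHS]/= (nth_map x0).
Qed.

Section Pattern.
(* Both ideals depend only on which slacks vanish, so the facets and vertices
   are replaced here by arbitrary finite types with a non-incidence relation. *)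
Variables (K : fieldType) (X Y : finType) (E : X -> Y -> bool).

Definition supp_type : finType := {e : X * Y | E e.1 e.2}.
Notation N := #|supp_type|.
Definition sym_entry (F : X) (v : Y) : {mpoly K[N]} :=
  if insub (F, v) is Some e then 'X_(enum_rank (e : supp_type)) else 0.
Definition adj : rel (X + Y) := fun x y =>
  match x, y with
  | inl F, inr v | inr v, inl F => E F v
  | _, _ => false
  end.
Definition node_label (x y : X + Y) : {mpoly K[N]} :=
  if (x, y) is (inl F, inr v) then sym_entry F v else 1.
Definition minor_ideal n : set {mpoly K[N]} :=
  saturation (ideal_gen (minors sym_entry n)) (\prod_(i < N) 'X_i).
Definition cycle_ideal : set {mpoly K[N]} :=
  ideal_gen [set \prod_(x <- c) node_label x (next c x) -
                 \prod_(x <- c) node_label (next c x) x | c in chordless_cycle adj].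

Lemma sym_entry0 F v : ~~ E F v -> sym_entry F v = 0.
Proof. by rewrite /sym_entry; case: insubP => //= e -> . Qed.

Lemma mpolyX_sym_entry i :
  'X_i = sym_entry (val (enum_val i : supp_type)).1 (val (enum_val i : supp_type)).2.
Proof. by rewrite /sym_entry -surjective_pairing valK enum_valK. Qed.

Lemma sym_entry_edge F v : E F v -> exists i : 'I_N, 
  sym_entry F v = 'X_i /\ val (enum_val i : supp_type) = (F, v).
Proof.
rewrite /sym_entry => EFv; case: insubP => [e _ ve|]; last by rewrite EFv.
by exists (enum_rank e); rewrite enum_rankK.
Qed.

Lemma adj_sym : ssrbool.symmetric adj. Proof. by move=> [F|v] [G|w]. Qed.
Lemma adj_irr : irreflexive adj. Proof. by move=> [F|v]. Qed.

Lemma node_label_one x y : adj x y -> node_label x y = 1 \/ node_label y x = 1.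
Proof. by case: x y => [F|v] [G|w] //= _; [right|left]. Qed.

Lemma minor_ideal_ideal n : is_ideal (minor_ideal n).
Proof. exact/saturation_ideal/ideal_gen_ideal. Qed.

Lemma minor_ideal_cancel n F v f :
  E F v -> minor_ideal n (sym_entry F v * f) -> minor_ideal n f.
Proof.
move=> /sym_entry_edge[i [-> _]]; apply: saturation_cancel; last first.
  by rewrite (bigD1 i).
exact: ideal_gen_ideal.
Qed.

Lemma minor_ideal_label_cancel n x y f :
  adj x y -> minor_ideal n (node_label x y * f) -> minor_ideal n f.
Proof.
case: x y => [F|v] [G|w] //=; first exact: minor_ideal_cancel.
by rewrite /node_label mul1r.
Qed.

Lemma cycle_ideal_ideal : is_ideal cycle_ideal.
Proof. exact: ideal_gen_ideal. Qed.

Lemma cycle_ideal_cycle (c : seq (X + Y)) : path.cycle adj c ->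
  balanced cycle_ideal node_label c.
Proof.
apply: (cycle_balanced cycle_ideal_ideal adj_sym adj_irr node_label_one) => {}c cc.
apply: sub_ideal_gen; exists c => //.
by case: cc => _ /andP[_ Uc] _; rewrite !cycle_prod_next.
Qed.

(** The walk from the facet [F i], start omitted, that alternates between the edges of two
    matchings: [F j] with [v (s j)], run from facet to vertex, and [F (s j)] with [v (s j)], run
    from vertex to facet. Its forward and backward products are thus the parts of two monomials
    along an orbit of [s]. *)
Fixpoint perm_walk n (F : 'I_n -> X) (v : 'I_n -> Y) (s : 'S_n) k i : seq (X + Y) :=
  if k is k'.+1 then inr (v (s i)) :: inl (F (s i)) :: perm_walk F v s k' (s i)
  else [::].

Lemma last_perm_walk n (F : 'I_n -> X) v (s : 'S_n) k i :
  last (inl (F i)) (perm_walk F v s k i) = inl (F (iter k s i)).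
Proof. by elim: k i => //= k IH i; rewrite IH -iterSr. Qed.

Lemma path_perm_walk n (F : 'I_n -> X) v (s : 'S_n) k i :
  (forall i, E (F i) (v i)) -> (forall i, E (F i) (v (s i))) ->
  path adj (inl (F i)) (perm_walk F v s k i).
Proof. by move=> H H'; elim: k i => //= k IH i; rewrite H H' IH. Qed.

Lemma walk_prod_perm_walk n (F : 'I_n -> X) v (s : 'S_n) k i :
  walk_prod node_label (inl (F i)) (perm_walk F v s k i) =
  \prod_(j <- traject s i k) sym_entry (F j) (v (s j)).
Proof.
elim: k i => [|k IH] i; first by rewrite walk_prod_nil big_nil.
by rewrite /= !walk_prod_cons IH big_cons /node_label mul1r.
Qed.

Lemma opp_walk_prod_perm_walk n (F : 'I_n -> X) v (s : 'S_n) k i :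
  walk_prod (opp_label node_label) (inl (F i)) (perm_walk F v s k i) =
  \prod_(j <- traject s i k) sym_entry (F (s j)) (v (s j)).
Proof.
elim: k i => [|k IH] i; first by rewrite walk_prod_nil big_nil.
by rewrite /= !walk_prod_cons IH big_cons /opp_label /node_label mul1r.
Qed.

Lemma ideal_prod_congr (I : set {mpoly K[N]}) (S : Type) (s : seq S)
    (P : pred S) (f g : S -> {mpoly K[N]}) :
  is_ideal I -> (forall i, P i -> I (f i - g i)) ->
  I (\prod_(i <- s | P i) f i - \prod_(i <- s | P i) g i).
Proof.
move=> [I0 D M] H; apply: (big_ind2 (fun x y => I (x - y))) => //.
  by rewrite subrr.
move=> x1 x2 y1 y2 H1 H2.
have -> : x1 * y1 - x2 * y2 = x1 * (y1 - y2) + y2 * (x1 - x2) by ring.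
by apply: D; apply: M.
Qed.

(* Each orbit of [s] traces a closed walk in the graph. *)
Lemma cycle_ideal_perm n (F : 'I_n -> X) (v : 'I_n -> Y) (s : 'S_n) :
  (forall i, E (F i) (v i)) -> (forall i, E (F i) (v (s i))) ->
  cycle_ideal (\prod_i sym_entry (F i) (v (s i)) - \prod_i sym_entry (F i) (v i)).
Proof.
move=> H H'.
(* Reindexed by [s], the second monomial collects exactly the backward labels of the walks. *)
rewrite [X in _ - X](reindex_inj (@perm_inj _ s)) /=.
rewrite [X in X - _](partition_big (porbit s) (mem (porbits s))) /=; last first.
  by move=> i _; apply: imset_f.
rewrite [X in _ - X](partition_big (porbit s) (mem (porbits s))) /=; last first.
  by move=> i _; apply: imset_f.
apply: ideal_prod_congr; first exact: cycle_ideal_ideal.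
move=> _ /imsetP[i _ ->].
have orb (f : 'I_n -> {mpoly K[N]}) :
    \prod_(j | porbit s j == porbit s i) f j =
    \prod_(j <- traject s i #|porbit s i|) f j.
  rewrite [RHS]big_uniq ?uniq_traject_porbit //=.
  by apply: eq_bigl => j; rewrite eq_porbit_mem porbit_traject.
rewrite !orb -walk_prod_perm_walk -opp_walk_prod_perm_walk.
have wl : last (inl (F i)) (perm_walk F v s #|porbit s i| i) = inl (F i).
  by rewrite last_perm_walk iter_porbit.
rewrite -!cycle_prod_belast //.
apply: cycle_ideal_cycle.
have := path_perm_walk #|porbit s i| i H H'.
case: (perm_walk F v s _ i) wl => // y w wl pw.
by rewrite /= -{2}wl /= -lastI -wl; move: pw; rewrite {1}wl.
Qed.

(** Rearranging [l'] makes the two lists agree facet by facet; their vertices then differ by a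
    permutation of positions, to which [cycle_ideal_perm] applies. *)
Lemma cycle_ideal_edges (l l' : seq (X * Y)) :
  all (fun e => E e.1 e.2) l -> all (fun e => E e.1 e.2) l' ->
  perm_eq (map fst l') (map fst l) -> perm_eq (map snd l') (map snd l) ->
  cycle_ideal (\prod_(e <- l') sym_entry e.1 e.2 - \prod_(e <- l) sym_entry e.1 e.2).
Proof.
move=> El El' P1 P2.
have [k kl' k1] := perm_eq_map_lift P1.
rewrite (perm_big _ kl') /=.
have {El'}Ek : all (fun e => E e.1 e.2) k by rewrite -(perm_all _ kl').
have {P2}P2 : perm_eq (map snd k) (map snd l).
  by apply: perm_trans P2; rewrite perm_sym; apply: perm_map.
have kl : size k = size l by have := congr1 size k1; rewrite !size_map.
case: l El P1 P2 k1 kl => [|e0 l'']; first by move=> _ _ _ _ /size0nil ->;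
  rewrite !big_nil subrr; case: cycle_ideal_ideal.
set l := e0 :: l'' => El _ P2 k1 kl.
have /tuple_permP[s sE] : perm_eq (map snd k) (map_tuple snd (in_tuple l)) := P2.
pose F (i : 'I_(size l)) := (nth e0 l i).1.
pose v (i : 'I_(size l)) := (nth e0 l i).2.
have kF (i : 'I_(size l)) : (nth e0 k i).1 = F i.
  by rewrite /F -!(nth_map _ e0.1) ?kl // k1.
have kv (i : 'I_(size l)) : (nth e0 k i).2 = v (s i).
  rewrite /v -(nth_map _ e0.2) ?kl // sE (nth_map i) ?size_enum_ord //.
  by rewrite nth_ord_enum tnth_map (tnth_nth e0).
rewrite (big_nth e0) kl big_mkord (big_nth e0) big_mkord.
under eq_bigr do rewrite kF kv.
apply: cycle_ideal_perm => i; first by apply: (all_nthP e0 El).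
by rewrite -kF -kv; apply: (all_nthP e0 Ek); rewrite kl.
Qed.

(** * The monomial map and its kernel *)

Notation M := #|{: X + Y}|.

Definition node_var (x : X + Y) : {mpoly K[M]} := 'X_(enum_rank x).

Definition toric_map : {mpoly K[N]} -> {mpoly K[M]} :=
  mmap (@mpolyC M K) (fun i => let e := val (enum_val i : supp_type) in
                       node_var (inl e.1) * node_var (inr e.2)).

HB.instance Definition _ := GRing.RMorphism.on toric_map.

Lemma toric_map_entry F v : toric_map (sym_entry F v) =
  if E F v then node_var (inl F) * node_var (inr v) else 0.
Proof.
case: ifP => [/sym_entry_edge[i [-> iE]]|/negbT/sym_entry0 ->]; last exact: rmorph0.
by rewrite /toric_map mmapX mmap1U iE.
Qed.

Lemma toric_map_edges (l : seq (X * Y)) : all (fun e => E e.1 e.2) l ->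
  toric_map (\prod_(e <- l) sym_entry e.1 e.2) =
  'X_[\sum_(e <- l) (U_(enum_rank (inl e.1 : X + Y)) + U_(enum_rank (inr e.2 : X + Y)))].
Proof.
move=> El; rewrite rmorph_prod /=; elim: l El => [|e l IH] /=.
  by rewrite !big_nil mpolyX0.
move=> /andP[Ee /IH El].
by rewrite !big_cons El toric_map_entry Ee !mpolyXD.
Qed.

Lemma monomial_edges (m : 'X_{1..N}) : exists2 l : seq (X * Y),
  all (fun e => E e.1 e.2) l & 'X_[m] = \prod_(e <- l) sym_entry e.1 e.2.
Proof.
exists (flatten [seq nseq (m i) (val (enum_val i : supp_type)) | i <- enum 'I_N]).
  apply/allP => e /flattenP[_ /mapP[i _ ->] /nseqP[-> _]].
  exact: (valP (enum_val i : supp_type)).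
rewrite big_flatten big_map big_enum /= mpolyXE_id; apply: eq_bigr => i _.
by rewrite big_nseq -mpolyX_sym_entry iter_mulr_1.
Qed.

Lemma toric_map_monomial (m : 'X_{1..N}) : exists mu, toric_map 'X_[m] = 'X_[mu].
Proof. by have [l /toric_map_edges lE ->] := monomial_edges m; rewrite lE; eexists. Qed.

Lemma mpolyX_inj n (m m' : 'X_{1..n}) : 'X_[K, m] = 'X_[m'] -> m = m'.
Proof.
move=> /(congr1 (mcoeff m)); rewrite !mcoeffX eqxx; case: eqP => [-> //|_].
by move/eqP; rewrite oner_eq0.
Qed.

(** The exponent of a node variable in the image counts the edges at that node, so equal images mean
    equal multisets of facets and of vertices. *)
Lemma toric_monomials m m' : toric_map 'X_[m'] = toric_map 'X_[m] ->
  cycle_ideal ('X_[m'] - 'X_[m]).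
Proof.
have [l El ->] := monomial_edges m; have [l' El' ->] := monomial_edges m'.
rewrite !toric_map_edges // => /mpolyX_inj mE.
have cnt (x : X + Y) k :
    (\sum_(e <- k) (U_(enum_rank (inl e.1 : X + Y)) + U_(enum_rank (inr e.2 : X + Y))))%MM (enum_rank x)
    = (\sum_(e <- k) ((inl e.1 == x) + (inr e.2 == x)))%N.
  rewrite mnm_sumE; apply: eq_bigr => e _.
  by rewrite mnmDE !mnm1E !(inj_eq enum_rank_inj).
have sum_count (S : eqType) (f : X * Y -> S) x k :
    (\sum_(e <- k) (f e == x))%N = count_mem x (map f k).
  by rewrite count_map -sumn_count sumnE big_map.
apply: cycle_ideal_edges => //; apply/allP => x _ /=; apply/eqP.
  have := cnt (inl x) l; rewrite -mE cnt -!sum_count.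
  by under eq_bigr do rewrite addn0; under [RHS]eq_bigr do rewrite addn0.
by have := cnt (inr x) l; rewrite -mE cnt -!sum_count.
Qed.

(** Monomials are grouped by their image. In each group the coefficients of [f] sum to zero, so
    subtracting one fixed representative from every monomial of the group does not change [f], and
    these differences lie in the cycle ideal. *)
Lemma toric_kernel f : toric_map f = 0 -> cycle_ideal f.
Proof.
have [I0 D Mul] := cycle_ideal_ideal.
move=> f0; pose deg m := xget 0%MM [set mu | toric_map 'X_[m] = 'X_[mu]].
have degP m : toric_map 'X_[m] = 'X_[deg m].
  by exact: (xgetPex 0%MM (toric_map_monomial m)).
pose rep mu := 'X_[K, xget 0%MM [set m : 'X_{1..N} | deg m = mu]].
have repP m : cycle_ideal ('X_[m] - rep (deg m)).
  apply: toric_monomials; rewrite !degP; congr 'X_[_].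
  by rewrite (xgetPex 0%MM (ex_intro (fun m' => deg m' = deg m) m erefl)).
have coef mu : \sum_(m <- msupp f | deg m == mu) f@_m = 0.
  rewrite -[RHS](mcoeff0 _ mu) -f0 /toric_map /mmap raddf_sum /= big_mkcond /=.
  apply: eq_bigr => m _; have := degP m; rewrite /toric_map mmapX => ->.
  rewrite mul_mpolyC mcoeffZ mcoeffX.
  by case: eqP; rewrite ?mulr1 ?mulr0.
have -> : f = \sum_(m <- msupp f) f@_m *: ('X_[m] - rep (deg m)).
  under eq_bigr do rewrite scalerBr.
  rewrite sumrB -mpolyE -[LHS]subr0; congr (_ - _).
  pose r := undup (map deg (msupp f)).
  transitivity (\sum_(m <- msupp f) \sum_(mu <- r | deg m == mu) f@_m *: rep mu).
    rewrite (exchange_big_dep xpredT) //= big1 // => mu _.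
    by rewrite -scaler_suml coef scale0r.
  rewrite big_seq [RHS]big_seq; apply: eq_bigr => m mf.
  under eq_bigl do rewrite eq_sym.
  rewrite -big_filter filter_pred1_uniq ?undup_uniq ?big_seq1 //.
  by rewrite mem_undup map_f.
apply: ideal_sum; first exact: cycle_ideal_ideal.
by move=> m _; rewrite -mul_mpolyC; apply: Mul.
Qed.

(* Every label has value 1 at the all-ones point, so cycle binomials vanish there. *)
Lemma cycle_ideal_at1 f : cycle_ideal f -> f.@[fun=> 1] = 0.
Proof.
have at1 x y : adj x y -> (node_label x y).@[fun=> 1] = 1.
  case: x y => [F|v] [G|w] //= => [/sym_entry_edge[i [iE _]]|_].
    by rewrite /node_label iE mevalXU.
  by rewrite /node_label meval1.
have idI : is_ideal [set f : {mpoly K[N]} | f.@[fun=> 1] = 0].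
  split=> /= [|g h g0 h0|g h h0]; first exact: meval0.
    by rewrite mevalD g0 h0 addr0.
  by rewrite mevalM h0 mulr0.
move: f; apply: (ideal_gen_sub idI) => _ [c [_ /andP[ec Uc] _] <-] /=.
rewrite mevalB !rmorph_prod /= !big_seq !big1 ?subrr // => x xc.
  by apply: at1; rewrite adj_sym; apply: next_cycle.
by apply: at1; apply: next_cycle.
Qed.

Definition entry01 F v : K := (E F v)%:R.

(** The image of the symbolic matrix is the 0/1 matrix multiplied by diagonal matrices of node
    variables on both sides. *)
Lemma toric_map_det n (r : 'I_n -> X) (c : 'I_n -> Y) :
  \det (\matrix_(i, j) entry01 (r i) (c j)) = 0 ->
  toric_map (\det (\matrix_(i, j) sym_entry (r i) (c j))) = 0.
Proof.
move=> d0; rewrite -det_map_mx /=.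
have -> : map_mx toric_map (\matrix_(i, j) sym_entry (r i) (c j)) =
    diag_mx (\row_i node_var (inl (r i))) *m
    map_mx (@mpolyC M K) (\matrix_(i, j) entry01 (r i) (c j)) *m
    diag_mx (\row_j node_var (inr (c j))).
  apply/matrixP => i j; rewrite mul_mx_diag mul_diag_mx !mxE toric_map_entry.
  rewrite /entry01; case: E; first by rewrite mpolyC1 mulr1.
  by rewrite mpolyC0 mulr0 mul0r.
by rewrite !det_mulmx det_map_mx d0 raddf0 mulr0 mul0r.
Qed.

(** The target of [toric_map] is an integral domain and no variable maps to zero, so membership in
    the kernel survives saturation. *)
Lemma minor_ideal_toric n :
  (forall (r : 'I_n -> X) (c : 'I_n -> Y),
     \det (\matrix_(i, j) entry01 (r i) (c j)) = 0) ->
  minor_ideal n `<=` cycle_ideal.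
Proof.
move=> d0 f [k Ik]; apply: toric_kernel.
have idI : is_ideal [set f | toric_map f = 0].
  split=> /= [|g h g0 h0|g h h0]; first exact: rmorph0.
    have -> : toric_map (g + h) = toric_map g + toric_map h by exact: rmorphD.
    by rewrite g0 h0 addr0.
  have -> : toric_map (g * h) = toric_map g * toric_map h by exact: rmorphM.
  by rewrite h0 mulr0.
have : toric_map ((\prod_(i < N) 'X_i) ^+ k * f) = 0.
  move: Ik; apply: (ideal_gen_sub idI) => _ [r [c [_ _ ->]]] /=.
  exact: toric_map_det.
have -> : toric_map ((\prod_(i < N) 'X_i) ^+ k * f) =
    (\prod_(i < N) toric_map 'X_i) ^+ k * toric_map f.
  by rewrite -(rmorph_prod toric_map) -(rmorphXn toric_map) -(rmorphM toric_map).
move=> /eqP; rewrite mulf_eq0 => /orP[|/eqP //].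
rewrite expf_eq0 => /andP[_ /prodf_eq0[i _]].
rewrite mpolyX_sym_entry toric_map_entry (valP (enum_val i : supp_type)).
by rewrite mulf_eq0 /node_var -!msupp_eq0 !msuppX.
Qed.

Lemma minor_ideal_det01 n : minor_ideal n = cycle_ideal ->
  forall (r : 'I_n -> X) (c : 'I_n -> Y),
     \det (\matrix_(i, j) entry01 (r i) (c j)) = 0.
Proof.
move=> IT r c.
have := ideal_minors sym_entry r c.
move=> /(@sub_saturation _ _ (\prod_(i < N) 'X_i)); rewrite -/(minor_ideal n _) IT.
move=> /cycle_ideal_at1; rewrite -det_map_mx => <-; congr (\det _).
apply/matrixP => i j; rewrite !mxE /entry01.
have [/sym_entry_edge[l [-> _]]|/sym_entry0 ->] := boolP (E (r i) (c j)).
  by rewrite /= mevalXU.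
by rewrite /= meval0.
Qed.

End Pattern.

Arguments minor_ideal K {X Y} E n _.
Arguments cycle_ideal K {X Y} E _.

(** * Splitting an incidence pattern *)

Lemma row_free_rowsub (K : fieldType) m q n (A : 'M[K]_(m, q)) (h : 'I_n -> 'I_m) :
  row_free A -> injective h -> row_free (rowsub h A).
Proof.
move=> fA hi; rewrite rowsubE /row_free mxrankMfree //.
apply/row_freeP; exists (rowsub h 1%:M)^T; apply/matrixP => i j.
rewrite !mxE (bigD1 (h i)) //= big1 => [|k kh].
  by rewrite !mxE eqxx mul1r addr0 (inj_eq hi) eq_sym.
by rewrite !mxE eq_sym (negPf kh) mul0r.
Qed.

(** Otherwise [n] independent rows could be chosen, and then [n] columns of these rows forming an
    invertible submatrix. The rank form is what allows a rank-one correction in [split_det01]. *)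
Lemma rank_lt_minors (K : fieldType) m q n (S : 'M[K]_(m, q)) :
  (forall f (g : 'I_n -> 'I_q), \det (mxsub f g S) = 0) -> (\rank S < n)%N.
Proof.
move=> d0; rewrite ltnNge; apply/negP => nS.
pose f := maxrankfun S \o widen_ord nS.
have fB : row_free (rowsub f S).
  rewrite rowsub_comp; apply: row_free_rowsub; first exact: maxrowsub_free.
  by move=> i j /(congr1 val) /= ij; apply: val_inj.
have fBt : row_full (rowsub f S)^T by rewrite /row_full mxrank_tr.
have := fullrowsub_full fBt; set g := fullrankfun fBt.
rewrite row_full_unit unitmxE -det_tr.
have -> : (rowsub g (rowsub f S)^T)^T = mxsub f g S.
  by apply/matrixP => i j; rewrite !mxE.
by rewrite d0 unitr0.
Qed.

Section SplitPattern.
Variables (K : fieldType) (X Y X' Y' : finType).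
Variables (E : X -> Y -> bool) (E' : X' -> Y' -> bool).
(* [lift b] and [vx b] embed the pattern of [P] in that of the split, sending
   [p] to its copy of sign [b]; the two images share the facets through [p] and
   the vertices other than [p]. *)
Variables (lift : bool -> X -> X') (vx : bool -> Y -> Y') (p : Y).
Hypothesis E'_same : forall b F v, E' (lift b F) (vx b v) = E F v.
Hypothesis lift_surj : forall F', exists b F, F' = lift b F.
Hypothesis vx_surj : forall v', exists b v, v' = vx b v.
Hypothesis vx_eq : forall v, v != p -> vx true v = vx false v.
Hypothesis lift_eq : forall F, ~~ E F p -> lift true F = lift false F.
Hypothesis E'_opp : forall b F, E' (lift b F) (vx (~~ b) p) = false.
Hypothesis vx_neq : forall v, vx true p <> vx false v.
Variable F0 : X.
Hypothesis EF0 : E F0 p.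

(** The nodes on which the two copies are glued. *)
Let good (x : X + Y) :=
  match x with inl F => ~~ E F p | inr v => v != p end.

Hypothesis good_conn : forall x y, good x -> good y ->
  exists q, [/\ path (adj E) x q, all good q & last x q = y].

Definition node_lift b (x : X + Y) : X' + Y' :=
  match x with inl F => inl (lift b F) | inr v => inr (vx b v) end.

Lemma adj_node_lift b x y : adj E' (node_lift b x) (node_lift b y) = adj E x y.
Proof. by case: x y => [F|v] [G|w] /=; rewrite ?E'_same. Qed.

Let N := #|supp_type E|.
Let N' := #|supp_type E'|.

Definition lift_map b : {mpoly K[N]} -> {mpoly K[N']} :=
  mmap (@mpolyC N' K) (fun i => let e := val (enum_val i : supp_type E) in
     sym_entry K E' (lift b e.1) (vx b e.2)).

HB.instance Definition _ b := GRing.RMorphism.on (lift_map b).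

Lemma lift_map_entry b F v :
  lift_map b (sym_entry K E F v) = sym_entry K E' (lift b F) (vx b v).
Proof.
have [EFv|nE] := boolP (E F v).
  have [i [-> iE]] := sym_entry_edge K EFv.
  by rewrite /lift_map mmapX mmap1U iE.
by rewrite !sym_entry0 ?E'_same //; apply: rmorph0.
Qed.

Lemma lift_map_label b x y :
  lift_map b (node_label K E x y) =
  node_label K E' (node_lift b x) (node_lift b y).
Proof.
by case: x y => [F|v] [G|w]; rewrite /node_label /= ?lift_map_entry //;
  apply: rmorph1.
Qed.

(* Bordering a minor with the column of the other copy of [p], which vanishes
   on the facets of this copy. *)
Lemma lift_map_minor b n (r : 'I_n -> X) (c : 'I_n -> Y) :
  minor_ideal K E' n.+1
    (\det (\matrix_(i, j) sym_entry K E' (lift b (r i)) (vx b (c j)))).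
Proof.
(* The corner of the bordered matrix is the entry of the added row, the lift of [F0] to the other
   copy. Since [F0] avoids [p], it is a variable and can be cancelled. *)
apply: (@minor_ideal_cancel K _ _ E' n.+1 (lift (~~ b) F0) (vx (~~ b) p)).
  by rewrite E'_same.
pose r' (i : 'I_n.+1) :=
  if unlift ord0 i is Some i' then lift b (r i') else lift (~~ b) F0.
pose c' (i : 'I_n.+1) :=
  if unlift ord0 i is Some i' then vx b (c i') else vx (~~ b) p.
have := ideal_minors (sym_entry K E') r' c'.
rewrite (expand_det_col _ ord0) (bigD1 ord0) //= big1 => [|i i0].
  rewrite addr0 mxE /r' /c' unlift_none /cofactor addn0 expr0 mul1r.
  set A := row' _ _; set B := \matrix_(i, j) _.
  have -> : A = B.
    by apply/matrixP => i j; rewrite !mxE !liftK.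
  exact: sub_saturation.
rewrite mxE /r' /c' unlift_none; case: unliftP i0 => [i' -> _|->]; last by rewrite eqxx.
by rewrite sym_entry0 ?mul0r // E'_opp.
Qed.

(** Variables go to variables, so the factors that saturate the ideal of [P] are cancelled one at a
    time in the saturated ideal of the split. *)
Lemma lift_map_ideal b n f :
  minor_ideal K E n f -> minor_ideal K E' n.+1 (lift_map b f).
Proof.
have [I0 D Mu] := minor_ideal_ideal K E' n.+1.
have mapM g h : lift_map b (g * h) = lift_map b g * lift_map b h by exact: rmorphM.
have mapD g h : lift_map b (g + h) = lift_map b g + lift_map b h by exact: rmorphD.
have idI : is_ideal [set f | minor_ideal K E' n.+1 (lift_map b f)].
  split=> /= [|g h g0 h0|g h h0].
  - by have -> : lift_map b 0 = 0 by exact: rmorph0.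
  - by rewrite mapD; apply: D.
  - by rewrite mapM; apply: Mu.
case=> k Ik.
have : minor_ideal K E' n.+1 (lift_map b ((\prod_(i < N) 'X_i) ^+ k * f)).
  move: Ik; apply: (ideal_gen_sub idI) => _ [r [c [_ _ ->]]] /=.
  have <- : \det (map_mx (lift_map b) (\matrix_(i, j) sym_entry K E (r i) (c j))) =
     lift_map b (\det (\matrix_(i, j) sym_entry K E (r i) (c j))) by exact: det_map_mx.
  suff -> : map_mx (lift_map b) (\matrix_(i, j) sym_entry K E (r i) (c j)) =
            \matrix_(i, j) sym_entry K E' (lift b (r i)) (vx b (c j)).
    exact: lift_map_minor.
  by apply/matrixP => i j; rewrite !mxE lift_map_entry.
elim: k {Ik} => [|k IH]; first by rewrite expr0 mul1r.
rewrite exprS -mulrA mapM => Ik; apply: IH; move: (lift_map b (_ * f)) Ik => g.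
rewrite (rmorph_prod (lift_map b)); elim: (index_enum _) => [|i s IHs].
  by rewrite big_nil mul1r.
rewrite big_cons -mulrA => Ik; apply: IHs; move: Ik.
rewrite /= mpolyX_sym_entry lift_map_entry; apply: minor_ideal_cancel.
by rewrite E'_same; apply: (valP (enum_val i : supp_type E)).
Qed.

Lemma lift_map_walk b f g x q :
  (forall x y, lift_map b (f x y) = g (node_lift b x) (node_lift b y)) ->
  lift_map b (walk_prod f x q) =
  walk_prod g (node_lift b x) (map (node_lift b) q).
Proof.
move=> fg; elim: q x => [|y q IH] x.
  by rewrite !walk_prod_nil; apply: rmorph1.
rewrite /= !walk_prod_cons -fg -IH; exact: rmorphM.
Qed.

Lemma lift_map_cycle b f g (c : seq (X + Y)) :
  (forall x y, lift_map b (f x y) = g (node_lift b x) (node_lift b y)) ->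
  lift_map b (cycle_prod f c) = cycle_prod g (map (node_lift b) c).
Proof.
case: c => [|x c] fg; first exact: rmorph1.
by rewrite /= -map_rcons; apply: lift_map_walk.
Qed.

Let side b : pred (X' + Y') := fun z => [exists x, node_lift b x == z].

Lemma side_node_lift b x : side b (node_lift b x).
Proof. by apply/existsP; exists x. Qed.

(** Choosing preimages pulls the walk back to a closed walk of [P]; its binomial lies in the cycle
    ideal, hence in the minor ideal, and [lift_map] carries it over. *)
Lemma side_balanced n b (c : seq (X' + Y')) :
  cycle_ideal K E `<=` minor_ideal K E n ->
  path.cycle (adj E') c -> all (side b) c ->
  balanced (minor_ideal K E' n.+1) (node_label K E') c.
Proof.
move=> TI ec sc.
pose back z := odflt (inr p) [pick x | node_lift b x == z].
have backK z : side b z -> node_lift b (back z) = z.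
  move=> /existsP[x xz]; rewrite /back; case: pickP => [y /eqP //|/(_ x)].
  by rewrite xz.
have cE : map (node_lift b) (map back c) = c.
  by rewrite -map_comp; apply: map_id_in => z zc; apply: backK; apply: (allP sc).
have : path.cycle (adj E) (map back c).
  rewrite -cE in ec; move: ec; case: (map back c) => //= x q.
  rewrite -map_rcons path_map; congr is_true; apply: eq_path => y z /=.
  exact: adj_node_lift.
move=> /(cycle_ideal_cycle K) /TI /(lift_map_ideal b).
have -> : lift_map b (cycle_prod (node_label K E) (map back c) -
      cycle_prod (opp_label (node_label K E)) (map back c)) =
   lift_map b (cycle_prod (node_label K E) (map back c)) -
   lift_map b (cycle_prod (opp_label (node_label K E)) (map back c)) by exact: rmorphB.
rewrite (lift_map_cycle _ (lift_map_label b)).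
rewrite (@lift_map_cycle b _ (opp_label (node_label K E'))) ?cE //.
by move=> x y; apply: lift_map_label.
Qed.

Lemma side_cover z : side true z || side false z.
Proof.
case: z => [F'|v'].
  have [b [F ->]] := lift_surj F'.
  by have := side_node_lift b (inl F); case: b => /= ->; rewrite ?orbT.
have [b [v ->]] := vx_surj v'.
by have := side_node_lift b (inr v); case: b => /= ->; rewrite ?orbT.
Qed.

(** A facet and a vertex of different signs can only be adjacent if the vertex is not a copy of [p],
    and such a vertex belongs to both sides. *)
Lemma side_facet_vertex F' v' : E' F' v' ->
  exists b, side b (inl F') && side b (inr v').
Proof.
have [b [F ->]] := lift_surj F'; have [d [v ->]] := vx_surj v'.
move=> Ebd; exists b; rewrite (side_node_lift b (inl F)) /=.
have [bd|bd] := eqVneq d b; first by rewrite bd (side_node_lift b (inr v)).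
have [vp|vp] := eqVneq v p.
  by move: Ebd bd; rewrite vp; case: b d => [] [] //;
     [rewrite (E'_opp true)|rewrite (E'_opp false)].
have -> : vx d v = vx b v by have := vx_eq vp; case: (b) (d) => [] [].
exact: (side_node_lift b (inr v)).
Qed.

Lemma side_edge x y : adj E' x y ->
  side true x && side true y || side false x && side false y.
Proof.
case: x y => [F|v] [G|w] //= /side_facet_vertex[b].
  by case: b => ->; rewrite ?orbT.
by rewrite andbC; case: b => ->; rewrite ?orbT.
Qed.

(** A facet lying on both sides contains both copies of [p], by [E'_opp] for each sign, so the facet
    of [P] below it passes through [p]. *)
Lemma side_both z : side true z && side false z ->
  exists2 x, good x & z = node_lift true x.
Proof.
move=> /andP[/existsP[x /eqP xz] /existsP[y /eqP yz]]; exists x => //.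
move: xz; rewrite -yz; case: x y {yz} => [F|v] [G|w] //= [].
  move=> FG; apply/negP => EF; have := E'_same true F p.
  by rewrite FG E'_opp EF.
by move=> vw; apply/eqP => vp; apply: (@vx_neq w); rewrite -vp.
Qed.

Lemma split_cycle_ideal n :
  cycle_ideal K E `<=` minor_ideal K E n ->
  cycle_ideal K E' `<=` minor_ideal K E' n.+1.
Proof.
move=> TI; apply: ideal_gen_sub; first exact: minor_ideal_ideal.
move=> _ [c [_ /andP[ec Uc] _] <-].
have := @glued_cycle_balanced _ _ (minor_ideal K E' n.+1) (adj E')
  (node_label K E') (minor_ideal_ideal _ _ _) (@adj_sym _ _ _)
  (side true) (side false) side_cover side_edge.
move=> /(_ (@minor_ideal_label_cancel _ _ _ _ _)).
move=> /(_ (fun c => @side_balanced n true c TI)).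
move=> /(_ (fun c => @side_balanced n false c TI)).
rewrite /balanced => glue; rewrite -[X in X - _]cycle_prod_next //.
rewrite -[X in _ - X](cycle_prod_next (opp_label _)) //; apply: glue => //.
move=> x y /side_both[u gu ->] /side_both[v gv ->].
have [q [eq gq <-]] := good_conn gu gv.
exists (map (node_lift true) q); split.
- by rewrite path_map; move: eq; congr is_true; apply: eq_path => s t /=;
    rewrite adj_node_lift.
- rewrite all_map; apply: sub_all gq => s gs /=.
  have -> : side false (node_lift true s).
    by case: s gs => [F|w] /= gs; rewrite ?lift_eq ?vx_eq //;
      [apply: (side_node_lift false (inl F))|apply: (side_node_lift false (inr w))].
  by rewrite side_node_lift.
- by rewrite last_map.
Qed.

(** The 0/1 columns of the two copies of [p] add up to the column of [p], repeated over the lifted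
    facets. Hence the column of [vx false p] is that repeated column minus [s], the column of
    [vx true p]; the row [k] records the coefficients of [s], namely 1, -1 and 0, and [C] blanks the
    columns where [s] stands alone. *)
Lemma split_det01 n :
  (forall (r : 'I_n -> X) (c : 'I_n -> Y),
     \det (\matrix_(i, j) entry01 K E (r i) (c j)) = 0) ->
  forall (r : 'I_n.+1 -> X') (c : 'I_n.+1 -> Y'),
     \det (\matrix_(i, j) entry01 K E' (r i) (c j)) = 0.
Proof.
move=> d0 r c.
have /choice[rF rFE] i : exists F, exists b, r i = lift b F.
  by have [b [F ->]] := lift_surj (r i); exists F, b.
have /choice[cv cvE] i : exists v, exists b, c i = vx b v.
  by have [b [v ->]] := vx_surj (c i); exists v, b.
pose S := \matrix_(i < #|X|, j < #|Y|) entry01 K E (enum_val i) (enum_val j).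
have rS : (\rank S < n)%N.
  apply: rank_lt_minors => f g; rewrite -[RHS](d0 (enum_val \o f) (enum_val \o g)).
  by congr (\det _); apply/matrixP => i j; rewrite !mxE.
pose A : 'M[K]_(n.+1, #|X|) := \matrix_(i, j) (enum_rank (rF i) == j)%:R.
pose C : 'M[K]_(#|Y|, n.+1) := \matrix_(i, j)
  ((enum_rank (cv j) == i) && (c j != vx true p))%:R.
pose s := \col_(i < n.+1) entry01 K E' (r i) (vx true p).
pose k : 'rV[K]_n.+1 := \row_j ((c j == vx true p)%:R - (c j == vx false p)%:R).
set M := \matrix_(i, j) _.
(* [A *m S *m C] repeats rows and columns of the 0/1 matrix of [P]. *)
have ME : M = A *m S *m C + s *m k.
  apply/matrixP => i j; rewrite !mxE big_ord1 !mxE.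
  rewrite (bigD1 (enum_rank (cv j))) //= big1 => [|l]; last first.
    by rewrite eq_sym => /negPf lj; rewrite !mxE lj mulr0.
  rewrite !mxE eqxx (bigD1 (enum_rank (rF i))) //= big1 => [|l]; last first.
    by rewrite eq_sym => /negPf lj; rewrite !mxE lj mul0r.
  rewrite !mxE eqxx !enum_rankK mul1r !addr0.
  have [b ->] := rFE i; move: (rF i) => F.
  have sumE : entry01 K E' (lift b F) (vx true p) +
              entry01 K E' (lift b F) (vx false p) = entry01 K E F p.
    rewrite /entry01; case: b; first by rewrite E'_same (E'_opp true) addr0.
    by rewrite E'_same (E'_opp false) add0r.
  have [cj|cj] := eqVneq (c j) (vx true p).
    rewrite cj; have /eqP/negPf -> := @vx_neq p.
    by rewrite mulr0 add0r subr0 mulr1.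
  have cjE : c j = vx false (cv j).
    have [[] // cd] := cvE j; rewrite cd vx_eq //.
    by apply: contra_neq cj => <-.
  rewrite cjE mulr1; have [cp|cp] := eqVneq.
    rewrite cp sub0r mulrN1.
    have -> : entry01 K E F (cv j) = entry01 K E F p.
      by rewrite /entry01 -(E'_same false) cp E'_same.
    by rewrite -sumE addrAC subrr add0r.
  rewrite subrr mulr0 addr0.
  have vp : cv j != p by apply: contra_neq cp => ->.
  have -> : vx false (cv j) = vx b (cv j) by case: (b) => //; rewrite vx_eq.
  by rewrite /entry01 E'_same.
have rM : (\rank M < n.+1)%N.
  rewrite ME ltnS; apply: leq_trans (mxrank_add _ _) _.
  have r1 : (\rank (A *m S *m C) <= \rank S)%N.
    by apply: leq_trans (mxrankM_maxl _ _) _; apply: mxrankM_maxr.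
  have r2 : (\rank (s *m k) <= 1)%N.
    by apply: leq_trans (mxrankM_maxl _ _) _; apply: rank_leq_col.
  lia.
apply: contraTeq rM; rewrite -unitfE -unitmxE -row_free_unit => /eqP ->.
by rewrite ltnn.
Qed.

Theorem split_pattern n :
  (cycle_ideal K E `<=` minor_ideal K E n ->
     cycle_ideal K E' `<=` minor_ideal K E' n.+1) /\
  (minor_ideal K E n = cycle_ideal K E ->
     minor_ideal K E' n.+1 = cycle_ideal K E').
Proof.
split=> [|IT]; first exact: split_cycle_ideal.
rewrite eqEsubset; split.
  exact/minor_ideal_toric/split_det01/minor_ideal_det01.
by apply: split_cycle_ideal; rewrite IT.
Qed.

End SplitPattern.

(** * Convex hulls of finite sets *)

Section Farkas.
Context {R : realType}.

Definition lin_eval n (k : 'cV[R]_n) (u : 'rV[R]_n) : R := (u *m k) 0 0.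

Lemma lin_evalZ n (k : 'cV[R]_n) a u : lin_eval k (a *: u) = a * lin_eval k u.
Proof. by rewrite /lin_eval -scalemxAl mxE. Qed.
Lemma lin_evalB n (k : 'cV[R]_n) u v : lin_eval k (u - v) = lin_eval k u - lin_eval k v.
Proof. by rewrite /lin_eval mulmxBl !mxE. Qed.
Lemma lin_eval_sum n (k : 'cV[R]_n) (I : Type) (r : seq I) (P : pred I) F :
  lin_eval k (\sum_(i <- r | P i) F i) = \sum_(i <- r | P i) lin_eval k (F i).
Proof. by rewrite /lin_eval mulmx_suml summxE. Qed.
Lemma lin_evalBl n (k l : 'cV[R]_n) u : lin_eval (k - l) u = lin_eval k u - lin_eval l u.
Proof. by rewrite /lin_eval mulmxBr !mxE. Qed.
Lemma lin_evalZl n a (k : 'cV[R]_n) u : lin_eval (a *: k) u = a * lin_eval k u.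
Proof. by rewrite /lin_eval -scalemxAr mxE. Qed.

(* Induction on the number of generators (Bartl): a functional that separates
   the first ones but not the last one is corrected after projecting along it. *)
Lemma farkas n (s : seq 'rV[R]_n) (b : 'rV[R]_n) :
  (exists c : nat -> R, (forall i, 0 <= c i) /\
     b = \sum_(i < size s) c i *: s`_i) \/
  (exists k, (forall v, v \in s -> 0 <= lin_eval k v) /\ lin_eval k b < 0).
Proof.
move: {2}(size s) (leqnn (size s)) => m; elim: m s b => [|m IH] s b.
  rewrite leqn0 => /nilP ->.
  have [->|b0] := eqVneq b 0.
    by left; exists (fun=> 0); split=> //; rewrite big_ord0.
  right; exists (- b^T); split=> //.
  have /rV0Pn[j bj] := b0.
  rewrite /lin_eval mulmxN mxE oppr_lt0 mxE (bigD1 j) //=.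
  rewrite ltr_pwDl //; last by apply: sumr_ge0 => i _; rewrite mxE -expr2 sqr_ge0.
  by rewrite mxE -expr2 exprn_even_gt0.
case: s => [|a s] sm; first exact: (IH [::]).
have [[c [c0 bE]]|[h [hs hb]]] := IH s b sm.
  left; exists (fun i => if i is j.+1 then c j else 0); split; first by case.
  by rewrite /= big_ord_recl scale0r add0r bE.
have [ha|ha] := leP 0 (lin_eval h a).
  right; exists h; split=> // v; rewrite in_cons => /orP[/eqP -> //|]; exact: hs.
pose pr v := v - (lin_eval h v / lin_eval h a) *: a.
have szm : (size (map pr s) <= m)%N by rewrite size_map.
have [[c [c0 bE]]|[g [gs gb]]] := IH (map pr s) (pr b) szm.
- left; pose t := lin_eval h b / lin_eval h a -
     \sum_(i < size s) c i * (lin_eval h s`_i / lin_eval h a).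
  exists (fun i => if i is j.+1 then c j else t); split.
    case=> // ; rewrite /t subr_ge0; apply: (@le_trans _ _ 0).
      apply: sumr_le0 => i _; apply: mulr_ge0_le0 => //.
      by apply: mulr_ge0_le0; [apply: hs; apply: mem_nth|rewrite invr_le0 ltW].
    by rewrite ltW // nmulr_rgt0 // invr_lt0.
  rewrite /= big_ord_recl /=.
  have : b = pr b + (lin_eval h b / lin_eval h a) *: a by rewrite subrK.
  move=> ->; rewrite bE size_map [RHS]addrC scalerBl scaler_suml.
  rewrite [RHS]addrA -sumrN [in RHS]addrAC -big_split /=; congr (_ + _).
  apply: eq_bigr => i _; rewrite (nth_map 0) // /pr scalerBr scalerA.
  by [].
- right; exists (g - (lin_eval g a / lin_eval h a) *: h).
  have gE v : lin_eval (g - (lin_eval g a / lin_eval h a) *: h) v = lin_eval g (pr v).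
    by rewrite lin_evalBl lin_evalZl lin_evalB lin_evalZ; ring.
  split=> [v|]; rewrite gE //.
  rewrite in_cons => /orP[/eqP ->|vs]; last exact/gs/map_f.
  by rewrite /pr divff ?lt_eqF // scale1r subrr /lin_eval mul0mx mxE.
Qed.

End Farkas.

Section Convexity.
Context {R : realType}.
Implicit Types d : nat.

(** On homogenized points affine functions are linear forms and affine independence is linear
    independence, so faces and dimensions become questions about ranks and kernels. *)
Definition homogenize d (x : 'rV[R]_d) : 'rV[R]_(d + 1) := row_mx x 1.
Definition functional d (h : 'cV[R]_d * R) : 'cV[R]_(d + 1) := col_mx h.1 h.2%:M.
Definition affine_of d (k : 'cV[R]_(d + 1)) : 'cV[R]_d * R := (usubmx k, dsubmx k 0 0).

Lemma affine_evalE d h (x : 'rV[R]_d) : affine_eval h x = lin_eval (functional h) (homogenize x).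
Proof.
by rewrite /affine_eval /lin_eval mul_row_col mul1mx [RHS]mxE; congr (_ + _); rewrite mxE.
Qed.

Lemma affine_ofK d : cancel (@affine_of d) (@functional d).
Proof.
move=> k; rewrite /functional /affine_of /= -[RHS]vsubmxK; congr col_mx.
by rewrite [RHS]mx11_scalar.
Qed.

Lemma functionalK d : cancel (@functional d) (@affine_of d).
Proof.
by case=> a b; rewrite /functional /affine_of col_mxKu col_mxKd mxE eqxx.
Qed.

Lemma affine_eval_of d k (x : 'rV[R]_d) : affine_eval (affine_of k) x = lin_eval k (homogenize x).
Proof. by rewrite affine_evalE affine_ofK. Qed.

Lemma homogenize_sum d n (c : 'I_n -> R) (y : 'I_n -> 'rV[R]_d) : \sum_i c i = 1 ->
  homogenize (\sum_i c i *: y i) = \sum_i c i *: homogenize (y i).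
Proof.
move=> c1; rewrite /homogenize.
have -> : \sum_i c i *: row_mx (y i) 1 =
    row_mx (\sum_i c i *: y i) ((\sum_i c i)%:M).
  apply/rowP => j; rewrite summxE; case: (split_ordP j) => k ->.
    by rewrite row_mxEl summxE; apply: eq_bigr => i _; rewrite [LHS]mxE row_mxEl [RHS]mxE.
  rewrite row_mxEr !ord1 [RHS]mxE eqxx mulr1n; apply: eq_bigr => i _.
  by rewrite mxE row_mxEr mxE mulr1.
by rewrite c1.
Qed.

Lemma affine_eval_sum d n h (c : 'I_n -> R) (y : 'I_n -> 'rV[R]_d) : \sum_i c i = 1 ->
  affine_eval h (\sum_i c i *: y i) = \sum_i c i * affine_eval h (y i).
Proof.
move=> c1; rewrite affine_evalE homogenize_sum // lin_eval_sum.
by apply: eq_bigr => i _; rewrite lin_evalZ affine_evalE.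
Qed.

Lemma conv_ge0 d (A : set 'rV[R]_d) h x : conv A x ->
  (forall y, A y -> 0 <= affine_eval h y) -> 0 <= affine_eval h x.
Proof.
move=> [n [y [c [Ay c0 c1 ->]]]] hA; rewrite affine_eval_sum //.
by apply: sumr_ge0 => i _; apply: mulr_ge0 => //; apply: hA.
Qed.

Lemma sub_conv d (A : set 'rV[R]_d) : A `<=` conv A.
Proof.
move=> x Ax; exists 1%N, (fun=> x), (fun=> 1); split=> //.
  by rewrite big_ord1.
by rewrite big_ord1 scale1r.
Qed.

Lemma conv_mono d (A B : set 'rV[R]_d) : A `<=` B -> conv A `<=` conv B.
Proof. by move=> AB x [n [y [c [Ay c0 c1 ->]]]]; exists n, y, c; split=> // i; apply: AB. Qed.

(** Farkas for the homogenized points; their last coordinate, constantly 1, forces the coefficients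
    to sum to 1. *)
Lemma conv_finite d (s : seq 'rV[R]_d) x :
  (forall h, (forall v, v \in s -> 0 <= affine_eval h v) -> 0 <= affine_eval h x) ->
  conv [set` s] x.
Proof.
move=> H; have [[c [c0 xE]]|[k [ks kx]]] := farkas (map (@homogenize d) s) (homogenize x).
  have {}xE : homogenize x = \sum_(i < size s) c i *: homogenize s`_i.
    by rewrite xE size_map; apply: eq_bigr => i _; rewrite (nth_map 0).
  have c1 : \sum_(i < size s) c i = 1.
    have := congr1 (fun u : 'rV[R]_(d + 1) => u 0 (rshift d 0)) xE.
    rewrite [LHS]row_mxEr mxE eqxx summxE /= => E1; apply: etrans (esym E1).
    apply: eq_bigr => i _.
    by rewrite mxE [homogenize _ _ _]row_mxEr mxE mulr1.
  exists (size s), (fun i : 'I__ => s`_i), (fun i : 'I__ => c i); split=> //.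
    by move=> i /=; apply: mem_nth.
  have := congr1 (@lsubmx _ 1 d 1) xE; rewrite -homogenize_sum //.
  by rewrite !row_mxKl.
have := H (affine_of k); rewrite affine_eval_of leNgt kx => /(_ _)/negP[] //.
by move=> v vs; rewrite affine_eval_of; apply: ks; apply: map_f.
Qed.

Lemma conv_sub_finite d (A : set 'rV[R]_d) (s : seq 'rV[R]_d) :
  A `<=` conv [set` s] -> conv A `<=` conv [set` s].
Proof.
move=> As x Ax; apply: conv_finite => h hs; apply: (conv_ge0 Ax) => y /As ys.
exact: (conv_ge0 ys).
Qed.

Lemma conv_face d (A : set 'rV[R]_d) h x : conv A x ->
  (forall y, A y -> 0 <= affine_eval h y) -> affine_eval h x = 0 ->
  conv (A `&` [set y | affine_eval h y = 0]) x.
Proof.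
move=> [n [y [c [Ay c0 c1 xE]]]] hA; rewrite xE affine_eval_sum //.
move=> /eqP; rewrite psumr_eq0; last by move=> i _; apply: mulr_ge0 => //; apply: hA.
move=> /allP hz.
have [i0 ci0] : exists i, c i != 0.
  apply: contrapT => N; move: c1; rewrite big1; first by move/esym/eqP; rewrite oner_eq0.
  by move=> i _; apply: contrapT => /eqP ci; apply: N; exists i.
have hy i : c i != 0 -> affine_eval h (y i) = 0.
  have := hz i (mem_index_enum _); rewrite mulf_eq0 => /orP[/eqP ->|/eqP //].
  by rewrite eqxx.
(* Points of weight zero may lie off the face; they are replaced by [y i0], which has nonzero weight
   and hence lies on it. *)
exists n, (fun i => if c i == 0 then y i0 else y i), c; split=> //.
  by move=> i; case: eqP => [_|/eqP ci]; split=> //=; apply: hy.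
by apply: eq_bigr => i _; case: eqP => // ->; rewrite !scale0r.
Qed.

Lemma conv1 d (x y : 'rV[R]_d) : conv [set x] y -> y = x.
Proof.
move=> [n [z [c [zx _ c1 ->]]]].
rewrite (eq_bigr (fun i => c i *: x)) => [|i _]; last by rewrite zx.
by rewrite -scaler_suml c1 scale1r.
Qed.

Lemma vertex_in_gens d (A : set 'rV[R]_d) x : vertex (conv A) x -> A x.
Proof.
move=> [h [h0 xE]].
have [cx hx] : (conv A `&` [set y | affine_eval h y = 0]) x by rewrite -xE.
have [n [y [c [Ay _ c1 xS]]]] := conv_face cx (fun y Ay => h0 y (sub_conv Ay)) hx.
case: n y c Ay c1 xS => [|n] y c Ay c1 xS.
  by move/esym/eqP: c1; rewrite big_ord0 oner_eq0.
have [Ay0 hy0] := Ay ord0.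
suff <- : y ord0 = x by [].
have : [set x] (y ord0) by rewrite xE; split=> //; apply: sub_conv.
by [].
Qed.

Lemma vertex_of_gens d (A : set 'rV[R]_d) x h : A x -> affine_eval h x = 0 ->
  (forall y, A y -> y != x -> 0 < affine_eval h y) -> vertex (conv A) x.
Proof.
move=> Ax hx hA.
have h0 y : A y -> 0 <= affine_eval h y.
  by move=> Ay; have [->|yx] := eqVneq y x; rewrite ?hx // ltW // hA.
exists h; split=> [y cy|]; first exact: (conv_ge0 cy).
apply/seteqP; split=> [y ->|y [cy hy]]; first by split=> //; apply: sub_conv.
apply: conv1; apply: conv_mono (conv_face cy h0 hy) => z [Az hz] /=.
by apply/eqP; apply: contraPT hz => zx; apply/eqP; rewrite gt_eqF ?hA.
Qed.

Lemma vertex_functional d (P : set 'rV[R]_d) x : vertex P x ->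
  exists h, [/\ affine_eval h x = 0, (forall y, P y -> 0 <= affine_eval h y)
              & (forall y, P y -> y != x -> 0 < affine_eval h y)].
Proof.
move=> [h [h0 xE]]; exists h.
have [Px hx] : (P `&` [set y | affine_eval h y = 0]) x by rewrite -xE.
split=> // y Py yx; rewrite lt_neqAle h0 // andbT; apply/eqP => hy.
have : [set x] y by rewrite xE; split.
by move/eqP; apply/negP.
Qed.

Lemma vertex_sub d (P : set 'rV[R]_d) x : vertex P x -> P x.
Proof. by move=> [h [_ xE]]; have [] : (P `&` [set y | affine_eval h y = 0]) x by rewrite -xE. Qed.

(** A generator that is not a vertex is redundant: an affine function nonnegative on the other
    generators and negative at [v] would, once shifted to vanish at [v], expose [v] as a vertex.
    Discarding such generators terminates. *)
Lemma polytope_vertices d (P : set 'rV[R]_d) : polytope P ->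
  exists s : seq 'rV[R]_d, [/\ P = conv [set` s] & vertex P = [set` s]].
Proof.
move=> [s PE]; have [n] := ubnP (size s); elim: n s PE => // n IH s PE sn.
have [sv|/existsNP[v /not_implyP[vs nv]]] :=
    pselect (forall v, v \in s -> vertex P v).
  exists s; split=> //; apply/seteqP; split=> v /=.
    by rewrite PE => /vertex_in_gens.
  exact: sv.
pose t := [seq w <- s | w != v].
have ts : (size t < size s)%N.
  by rewrite size_filter -(count_predC (fun w => w != v) s) -{1}[count _ s]addn0
     ltn_add2l -has_count; apply/hasP; exists v => //=; rewrite eqxx.
have vt : conv [set` t] v.
  apply: conv_finite => h ht; rewrite leNgt; apply/negP => hv; apply: nv.
  rewrite PE; apply: (@vertex_of_gens _ _ _ (h.1, h.2 - affine_eval h v)) => //.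
    by rewrite /affine_eval /=; ring.
  move=> y /= ys yv.
  have : 0 <= affine_eval h y by apply: ht; rewrite mem_filter yv ys.
  rewrite (_ : affine_eval (_, _) y = affine_eval h y - affine_eval h v); last first.
    by rewrite /affine_eval /= addrA.
  by move=> hy; rewrite subr_gt0; apply: lt_le_trans hy.
apply: (IH t); last exact: leq_trans ts sn.
rewrite PE; apply/seteqP; split.
  apply: conv_sub_finite => w /= ws; have [->//|wv] := eqVneq w v.
  by apply: sub_conv; rewrite /= mem_filter wv.
by apply: conv_mono => w /=; rewrite mem_filter => /andP[].
Qed.

End Convexity.

(** * Affine dimension and facets *)

Section Dimension.
Context {R : realType}.
Implicit Types d : nat.

Lemma homogenize_eq0 d n (c : 'rV[R]_n) (y : 'I_n -> 'rV[R]_d) :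
  c *m (\matrix_i homogenize (y i)) = row_mx (\sum_i c 0 i *: y i) (\sum_i c 0 i)%:M.
Proof.
apply/rowP => j; rewrite mxE; case: (split_ordP j) => k ->.
  rewrite row_mxEl summxE; apply: eq_bigr => i _.
  by rewrite mxE [homogenize _ _ _]row_mxEl mxE.
rewrite row_mxEr mxE !ord1 eqxx mulr1n; apply: eq_bigr => i _.
by rewrite mxE [homogenize _ _ _]row_mxEr mxE eqxx mulr1.
Qed.

Lemma affinely_independentE d n (y : 'I_n -> 'rV[R]_d) :
  affinely_independent y <-> row_free (\matrix_i homogenize (y i)).
Proof.
split=> [H|/row_freeP[B MB] c c0 y0].
  apply: inj_row_free => c; rewrite homogenize_eq0 => /eqP.
  rewrite row_mx_eq0 => /andP[/eqP y0 /eqP c0].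
  have {}c0 : \sum_i c 0 i = 0.
    by move: c0 => /matrixP/(_ 0 0); rewrite !mxE eqxx mulr1n.
  by apply/rowP => i; rewrite mxE; apply: (H (fun i => c 0 i)).
have : (\row_i c i) *m (\matrix_i homogenize (y i)) = 0.
  rewrite homogenize_eq0; under eq_bigr do rewrite mxE.
  rewrite y0; under eq_bigr do rewrite mxE.
  by rewrite c0 raddf0 row_mx0.
move/(congr1 (mulmx^~ B)); rewrite -mulmxA MB mulmx1 mul0mx => /rowP E i.
by have := E i; rewrite !mxE.
Qed.

Lemma adim1_ge d (A : set 'rV[R]_d) n (y : 'I_n -> 'rV[R]_d) :
  (forall i, A (y i)) -> row_free (\matrix_i homogenize (y i)) -> (n <= adim1 A)%N.
Proof.
move=> Ay fy; have nd : (n < d.+2)%N.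
  by have := rank_leq_col (\matrix_i homogenize (y i)); rewrite (eqP fy) addn1.
rewrite /adim1 (_ : n = Ordinal nd) //; apply: leq_bigmax_cond.
by apply/asboolP; exists y; split=> //; apply/affinely_independentE.
Qed.

Lemma adim1_basis d (A : set 'rV[R]_d) : exists y : 'I_(adim1 A) -> 'rV[R]_d,
  (forall i, A (y i)) /\ row_free (\matrix_i homogenize (y i)).
Proof.
pose Q (n : 'I_d.+2) := `[< exists y : 'I_n -> 'rV[R]_d,
  (forall i, A (y i)) /\ affinely_independent y >].
rewrite (_ : adim1 A = \max_(n | Q n) val n) //.
have [|i Qi ->] := @eq_bigmax_cond _ Q val.
  apply/card_gt0P; exists ord0; apply/asboolP.
  by exists (fun=> 0); split=> [[]//|c _ _ []].
by move/asboolP: Qi => [y [Ay /affinely_independentE fy]]; exists y.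
Qed.

Lemma row_free_col_mx (K : fieldType) n m (u : 'rV[K]_m) (M : 'M[K]_(n, m)) :
  row_free M -> ~~ (u <= M)%MS -> row_free (col_mx u M).
Proof.
move=> /eqP rM uM; rewrite /row_free eqn_leq rank_leq_row /=.
suff : (\rank M < \rank (col_mx u M))%N by rewrite rM.
apply: rank_ltmx; rewrite ltmxE -!addsmxE addsmxSr /=.
by apply: contra uM; apply: submx_trans; apply: addsmxSl.
Qed.

(** The rows of [H] are a largest affinely independent family; a point of [A] outside their span
    would enlarge it. *)
Lemma adim1_hull d (A : set 'rV[R]_d) : exists H : 'M[R]_(adim1 A, d + 1),
  [/\ \rank H = adim1 A, forall x, A x -> (homogenize x <= H)%MS
    & forall i, exists2 x, A x & row i H = homogenize x].
Proof.
have [y [Ay fy]] := adim1_basis A.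
exists (\matrix_i homogenize (y i)); split; first exact/eqP.
  move=> x Ax; apply: contraT => nx.
  pose z (i : 'I_(1 + adim1 A)) := if fintype.split i is inr j then y j else x.
  suff : (1 + adim1 A <= adim1 A)%N by rewrite add1n ltnn.
  apply: (@adim1_ge _ _ _ z); first by move=> i; rewrite /z; case: fintype.split.
  have -> : \matrix_i homogenize (z i) = col_mx (homogenize x) (\matrix_i homogenize (y i)).
    apply/row_matrixP => i; rewrite rowK /z.
    case: fintype.splitP => j ij.
      by rewrite (_ : i = lshift _ j) ?rowKu ?row_id //; apply: val_inj.
    by rewrite (_ : i = rshift 1 j) ?rowKd ?rowK //; apply: val_inj.
  exact: row_free_col_mx.
by move=> i; exists (y i) => //; rewrite rowK.
Qed.

Lemma adim1_le d (A : set 'rV[R]_d) m (H : 'M[R]_(m, d + 1)) :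
  (forall x, A x -> (homogenize x <= H)%MS) -> (adim1 A <= \rank H)%N.
Proof.
have [y [Ay /eqP <-]] := adim1_basis A => AH; apply: mxrankS.
by apply/row_subP => i; rewrite rowK; apply: AH.
Qed.

Lemma homogenize_conv d (A : set 'rV[R]_d) m (H : 'M[R]_(m, d + 1)) x :
  (forall y, A y -> (homogenize y <= H)%MS) -> conv A x -> (homogenize x <= H)%MS.
Proof.
move=> AH [n [y [c [Ay _ c1 ->]]]]; rewrite homogenize_sum //.
by apply: summx_sub => i _; apply: scalemx_sub; apply: AH.
Qed.

Lemma lin_eval_sub n m (k : 'cV[R]_n) (H : 'M[R]_(m, n)) u :
  (forall i, lin_eval k (row i H) = 0) -> (u <= H)%MS -> lin_eval k u = 0.
Proof.
move=> H0 /submxP[w ->]; rewrite /lin_eval -mulmxA.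
have -> : H *m k = 0.
  by apply/colP => i; have := H0 i; rewrite /lin_eval -row_mul mxE => ->; rewrite mxE.
by rewrite mulmx0 mxE.
Qed.

Lemma full_dim_functional0 d (P : set 'rV[R]_d) k : full_dimensional P ->
  (forall x, P x -> lin_eval k (homogenize x) = 0) -> k = 0.
Proof.
move=> full P0; have [H [rH _ HP]] := adim1_hull P.
have fH : row_full H by rewrite /row_full rH full addn1.
apply/colP => j; rewrite mxE.
have -> : k j 0 = lin_eval k (delta_mx 0 j) by rewrite /lin_eval -rowE mxE.
apply: (@lin_eval_sub _ _ _ H); last exact: submx_full.
by move=> i; have [x Px ->] := HP i; apply: P0.
Qed.

(** Generators off the zero set of [k] give zero rows instead of being removed, so the matrix type
    does not depend on [k]. If [k] is nonnegative on [V], the rank is one more than the dimension of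
    the face it cuts. *)
Definition zero_rows d (V : seq 'rV[R]_d) k : 'M[R]_(size V, d + 1) :=
  \matrix_i (if lin_eval k (homogenize V`_i) == 0 then homogenize V`_i else 0).

Section FacetSpan.
Variables (d : nat) (P : set 'rV[R]_d) (V : seq 'rV[R]_d).
Hypothesis PE : P = conv [set` V].
Hypothesis fullP : full_dimensional P.

Lemma zero_rows_mul k : zero_rows V k *m k = 0.
Proof.
apply/colP => i; rewrite [RHS]mxE.
have -> : (zero_rows V k *m k) i 0 = lin_eval k (row i (zero_rows V k)).
  by rewrite /lin_eval -row_mul [RHS]mxE.
by rewrite rowK; case: eqP => // _; rewrite /lin_eval mul0mx mxE.
Qed.

Lemma full_dim_gens0 k : (forall v, v \in V -> lin_eval k (homogenize v) = 0) -> k = 0.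
Proof.
move=> V0; apply: (full_dim_functional0 fullP) => x.
rewrite PE => -[n [y [c [Vy _ c1 ->]]]].
rewrite homogenize_sum // lin_eval_sum big1 // => i _.
by rewrite lin_evalZ V0 ?mulr0 //; apply: Vy.
Qed.

Lemma zero_rows_lt k k' :
  (forall i : 'I_(size V), lin_eval k (homogenize V`_i) = 0 -> lin_eval k' (homogenize V`_i) = 0) ->
  (exists j : 'I_(size V), lin_eval k (homogenize V`_j) != 0 /\ lin_eval k' (homogenize V`_j) = 0) ->
  (\rank (zero_rows V k) < \rank (zero_rows V k'))%N.
Proof.
move=> kk' [j [kj k'j]]; apply: rank_ltmx; rewrite ltmxE; apply/andP; split.
  apply/row_subP => i; rewrite rowK; case: eqP => [/kk' ki|_]; last exact: sub0mx.
  by rewrite (_ : homogenize _ = row i (zero_rows V k')) ?row_sub // rowK ki eqxx.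
apply: contra kj => sub.
have : (homogenize V`_j <= zero_rows V k)%MS.
  apply: submx_trans sub.
  by rewrite (_ : homogenize _ = row j (zero_rows V k')) ?row_sub // rowK k'j eqxx.
move=> /submxP[w ->]; rewrite /lin_eval -mulmxA zero_rows_mul.
by rewrite mulmx0 mxE.
Qed.

Lemma zero_rows_facet k : (forall v, v \in V -> 0 <= lin_eval k (homogenize v)) ->
  \rank (zero_rows V k) = d ->
  facet P (P `&` [set x | affine_eval (affine_of k) x = 0]) /\
  cuts_face P (affine_of k) (P `&` [set x | affine_eval (affine_of k) x = 0]).
Proof.
move=> k0 rk; set F := _ `&` _.
have cF : cuts_face P (affine_of k) F.
  split=> // x; rewrite PE => /conv_ge0; apply => y /= yV.
  by rewrite affine_eval_of; apply: k0.
split=> //; split; first by exists (affine_of k).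
rewrite fullP; congr _.+1; apply/eqP; rewrite eqn_leq.
suff [] : (adim1 F <= \rank (zero_rows V k))%N /\
          (\rank (zero_rows V k) <= adim1 F)%N by rewrite rk => -> ->.
split.
  apply: adim1_le => x [Px kx]; move: Px; rewrite PE => Px.
  have V0 y : [set` V] y -> 0 <= affine_eval (affine_of k) y.
    by move=> /= yV; rewrite affine_eval_of; apply: k0.
  apply: homogenize_conv (conv_face Px V0 kx).
  move=> y [/= yV] /=; rewrite affine_eval_of => ky.
  have iV : (index y V < size V)%N by rewrite index_mem.
  rewrite (_ : homogenize y = row (Ordinal iV) (zero_rows V k)) ?row_sub //.
  by rewrite rowK /= nth_index // ky eqxx.
have [H [rH FH _]] := adim1_hull F.
rewrite -rH; apply: mxrankS; apply/row_subP => i.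
rewrite rowK; case: eqP => [ki|_]; last exact: sub0mx.
apply: FH; split; last by rewrite /= affine_eval_of.
by rewrite PE; apply: sub_conv; apply: mem_nth.
Qed.

(* If the zero set of [k] is too small for a facet, some [g], not proportional
   to [k], vanishes on it too, and the extreme members of the pencil [g - t k]
   which keep a sign on [P] vanish at more vertices. *)
Lemma facet_span k u :
  (forall v, v \in V -> 0 <= lin_eval k (homogenize v)) ->
  (forall F h, facet P F -> cuts_face P h F ->
     (forall v, v \in V -> lin_eval k (homogenize v) = 0 -> F v) ->
     lin_eval (functional h) u = 0) ->
  lin_eval k u = 0.
Proof.
have [n] := ubnP (d.+1 - \rank (zero_rows V k))%N.
elim: n k => // n IH k kn k0 hu.
have [->|kN0] := eqVneq k 0; first by rewrite /lin_eval mulmx0 mxE.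
have rkd : (\rank (zero_rows V k) <= d)%N.
  have := mulmx0_rank_max (zero_rows_mul k).
  have : (0 < \rank k)%N by rewrite lt0n mxrank_eq0.
  lia.
have [rk|rk] := eqVneq (\rank (zero_rows V k)) d.
  have [fF cF] := zero_rows_facet k0 rk.
  rewrite -(affine_ofK k); apply: (hu _ _ fF cF) => v vV kv.
  split; last by rewrite /= affine_eval_of.
  by rewrite PE; apply: sub_conv.
(* The rank is now below [d], so the annihilator of the rows in dimension [d + 1] has dimension at
   least two and is not exhausted by multiples of [k]. *)
have [g [g0 gk]] : exists g : 'cV[R]_(d + 1), zero_rows V k *m g = 0 /\ forall a, g != a *: k.
  pose C := cokermx (zero_rows V k).
  have : ~~ (C^T <= k^T)%MS.
    apply/negP => /mxrankS; rewrite !mxrank_tr mxrank_coker.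
    have := rank_leq_col k; lia.
  move=> /row_subPn[i Ci]; exists (col i C); split.
    by rewrite colE mulmxA mulmx_coker mul0mx.
  move=> a; apply: contra Ci => /eqP Ci.
  by rewrite -tr_col Ci linearZ; apply: scalemx_sub.
pose ev l (i : 'I_(size V)) := lin_eval l (homogenize V`_i).
have evV l v : v \in V -> exists i, lin_eval l (homogenize v) = ev l i.
  move=> vV; have iV : (index v V < size V)%N by rewrite index_mem.
  by exists (Ordinal iV); rewrite /ev /= nth_index.
have k0i i : 0 <= ev k i by apply: k0; apply: mem_nth.
have gz i : ev k i = 0 -> ev g i = 0.
  move=> ki; have := congr1 (fun M : 'cV[R]__ => M i 0) g0.
  rewrite [RHS]mxE => <-.
  have -> : (zero_rows V k *m g) i 0 = lin_eval g (row i (zero_rows V k)).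
    by rewrite /lin_eval -row_mul [RHS]mxE.
  by rewrite rowK; move: ki; rewrite /ev => ->; rewrite eqxx.
have [i0 ki0] : exists i, 0 < ev k i.
  apply: contrapT => N; move/eqP: kN0; apply; apply: full_dim_gens0 => v.
  move=> /(evV k)[i ->]; apply/eqP; rewrite eq_le k0i andbT leNgt.
  by apply/negP => ki; apply: N; exists i.
have [im kim imP] := @arg_minP _ R _ i0 (fun i => 0 < ev k i) (fun i => ev g i / ev k i) ki0.
have [iM kiM iMP] := @arg_maxP _ R _ i0 (fun i => 0 < ev k i) (fun i => ev g i / ev k i) ki0.
set m := ev g im / ev k im in imP; set M := ev g iM / ev k iM in iMP.
have evl a b i : ev (a *: g + b *: k) i = a * ev g i + b * ev k i.
  by rewrite /ev /lin_eval mulmxDr -!scalemxAr [LHS]mxE; congr (_ + _); rewrite [LHS]mxE.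
pose k1 := 1 *: g + (- m) *: k; pose k2 := (- 1) *: g + M *: k.
have k1P i : 0 <= ev k1 i.
  rewrite evl; have [ki|ki] := eqVneq (ev k i) 0; first by rewrite gz // ki !mulr0 addr0.
  have kp : 0 < ev k i by rewrite lt0r ki k0i.
  by have := imP _ kp; rewrite /= ler_pdivlMr //; lra.
have k2P i : 0 <= ev k2 i.
  rewrite evl; have [ki|ki] := eqVneq (ev k i) 0; first by rewrite gz // ki !mulr0 addr0.
  have kp : 0 < ev k i by rewrite lt0r ki k0i.
  by have := iMP _ kp; rewrite /= ler_pdivrMr //; lra.
have step l a b : l = a *: g + b *: k -> (forall i, 0 <= ev l i) ->
    (exists j, 0 < ev k j /\ ev l j = 0) -> lin_eval l u = 0.
  move=> lE lP [j [kj lj]].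
  have lz i : ev k i = 0 -> ev l i = 0.
    by move=> ki; rewrite lE evl gz // ki !mulr0 addr0.
  apply: IH.
  - have : (\rank (zero_rows V k) < \rank (zero_rows V l))%N.
      by apply: zero_rows_lt => //; exists j; rewrite gt_eqF.
    lia.
  - by move=> v /(evV l)[i ->].
  - move=> F h fF cF Fl; apply: (hu F h fF cF) => v vV kv; apply: Fl => //.
    have iV : (index v V < size V)%N by rewrite index_mem.
    have := lz (Ordinal iV); rewrite /ev /= nth_index //; exact.
have k1u : lin_eval k1 u = 0.
  apply: (step _ _ _ erefl k1P); exists im; split=> //; rewrite evl /m.
  by rewrite mul1r mulNr divfK ?subrr // gt_eqF.
have k2u : lin_eval k2 u = 0.
  apply: (step _ _ _ erefl k2P); exists iM; split=> //; rewrite evl /M.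
  by rewrite mulN1r divfK ?addNr // gt_eqF.
have mM : m != M.
  apply: contraTneq isT => mM; have := gk m; rewrite -subr_eq0 => /negP; case.
  have -> : g - m *: k = k1 by rewrite /k1 scale1r scaleNr.
  apply/eqP; apply: full_dim_gens0 => v /(evV k1)[i ->].
  by have := k1P i; have := k2P i; rewrite !evl -mM => *; lra.
have : lin_eval (k1 + k2) u = 0.
  by rewrite /lin_eval mulmxDr mxE [X in X + _]k1u [X in _ + X]k2u addr0.
have -> : k1 + k2 = (M - m) *: k.
  by rewrite /k1 /k2 scale1r scaleN1r scalerBl scaleNr addrACA subrr add0r addrC.
rewrite lin_evalZl => /eqP; rewrite mulf_eq0 subr_eq0 eq_sym (negPf mM) /=.
by move/eqP.
Qed.

End FacetSpan.
End Dimension.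

(** * Facets characterized by the functionals vanishing on them *)

Section Faces.
Context {R : realType}.
Implicit Types d : nat.

Lemma hull_functional0 d (A : set 'rV[R]_d) m (H : 'M[R]_(m, d + 1)) k :
  (forall i, exists2 x, A x & row i H = homogenize x) ->
  (forall x, A x -> lin_eval k (homogenize x) = 0) -> H *m k = 0.
Proof.
move=> HA A0; apply/colP => i; rewrite [RHS]mxE.
have [x Ax iE] := HA i; have := A0 x Ax.
by rewrite -iE /lin_eval -row_mul mxE.
Qed.

Lemma full_dim_of_functionals d (P : set 'rV[R]_d) :
  (forall k, (forall x, P x -> lin_eval k (homogenize x) = 0) -> k = 0) ->
  full_dimensional P.
Proof.
move=> P0; have [H [rH PH _]] := adim1_hull P.
have H0 : kermx H^T = 0.
  apply/row_matrixP => i; rewrite row0.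
  suff : (row i (kermx H^T))^T = 0 by move/(congr1 trmx); rewrite trmxK trmx0.
  apply: P0 => x /PH /submxP[w ->].
  have := row_sub i (kermx H^T) => /sub_kermxP/(congr1 trmx).
  by rewrite trmx_mul trmxK trmx0 /lin_eval -mulmxA => ->; rewrite mulmx0 mxE.
have := mxrank_ker H^T; rewrite H0 mxrank0 mxrank_tr rH.
have := rank_leq_col H; rewrite rH /full_dimensional; lia.
Qed.

Lemma functional_neq0 d (P : set 'rV[R]_d) h F : full_dimensional P ->
  cuts_face P h F -> (adim1 F < adim1 P)%N -> functional h != 0.
Proof.
move=> full [h0 FE] FP; apply/eqP => hz; move: FP; rewrite ltnNge => /negP; apply.
suff -> : F = P by [].
rewrite FE; apply/seteqP; split=> [x []//|x Px]; split=> //=.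
by rewrite affine_evalE hz /lin_eval mulmx0 mxE.
Qed.

(** The homogenized facet spans a hyperplane, whose annihilator is a line. Together with the
    converse below, this replaces dimension counts by proportionality of functionals, which
    transfers easily between [P] and its split. *)
Lemma facet_functionals d (P : set 'rV[R]_d) h F k : full_dimensional P ->
  facet P F -> cuts_face P h F ->
  (forall x, F x -> lin_eval k (homogenize x) = 0) ->
  exists a, k = a *: functional h.
Proof.
move=> full [_ dF] cF Fk; have [H [rH FH HF]] := adim1_hull F.
have hN0 : functional h != 0 by apply: functional_neq0 cF _; rewrite // -dF.
have rK : \rank (kermx H^T) = 1%N.
  by rewrite mxrank_ker mxrank_tr rH; move: dF; rewrite full; lia.
have sub l : (forall x, F x -> lin_eval l (homogenize x) = 0) -> (l^T <= kermx H^T)%MS.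
  by move=> Fl; apply/sub_kermxP; rewrite -trmx_mul (hull_functional0 HF Fl) trmx0.
have hF x : F x -> lin_eval (functional h) (homogenize x) = 0.
  by case: cF => _ ->; case => _ /=; rewrite affine_evalE.
have : (k^T <= (functional h)^T)%MS.
  apply: submx_trans (sub _ Fk) _; rewrite -(mxrank_leqif_sup (sub _ hF)).
  by rewrite rK eqn_leq mxrank_tr rank_leq_col lt0n mxrank_eq0 hN0.
move=> /sub_rVP[a /(congr1 trmx)]; rewrite trmxK linearZ /= trmxK => ->.
by exists a.
Qed.

Lemma facet_of_functionals d (P : set 'rV[R]_d) h F : full_dimensional P ->
  functional h != 0 -> cuts_face P h F ->
  (forall k, (forall x, F x -> lin_eval k (homogenize x) = 0) ->
     exists a, k = a *: functional h) ->
  facet P F.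
Proof.
move=> full hN0 cF Fk; split; first by exists h.
have [H [rH FH HF]] := adim1_hull F.
have hF x : F x -> lin_eval (functional h) (homogenize x) = 0.
  by case: cF => _ ->; case => _ /=; rewrite affine_evalE.
have r1 : (1 <= \rank (kermx H^T))%N.
  have : ((functional h)^T <= kermx H^T)%MS.
    by apply/sub_kermxP; rewrite -trmx_mul (hull_functional0 HF hF) trmx0.
  move/mxrankS; rewrite mxrank_tr; apply: leq_trans.
  by rewrite lt0n mxrank_eq0.
have r2 : (\rank (kermx H^T) <= 1)%N.
  apply: leq_trans (_ : \rank ((functional h)^T) <= 1)%N; last by rewrite rank_leq_row.
  apply: mxrankS; apply/row_subP => i.
  have [a aE] : exists a, (row i (kermx H^T))^T = a *: functional h.
    apply: Fk => x /FH /submxP[w ->].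
    have := row_sub i (kermx H^T) => /sub_kermxP/(congr1 trmx).
    by rewrite trmx_mul trmxK trmx0 /lin_eval -mulmxA => ->; rewrite mulmx0 mxE.
  by rewrite -[row _ _]trmxK aE linearZ; apply: scalemx_sub.
move: r1 r2; rewrite mxrank_ker mxrank_tr rH full; lia.
Qed.

Lemma face_conv_gens d (s : seq 'rV[R]_d) F : face (conv [set` s]) F ->
  F = conv [set` [seq v <- s | v \in F]].
Proof.
move=> [h [h0 FE]]; have s0 v : [set` s] v -> 0 <= affine_eval h v.
  by move=> sv; apply/h0/sub_conv.
apply/seteqP; split=> x.
  rewrite {1}FE => -[cx hx]; apply: conv_mono (conv_face cx s0 hx) => v [/= sv hv].
  rewrite mem_filter sv andbT; apply/mem_set; rewrite FE; split=> //.
  exact: sub_conv.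
move=> cx; have sF v : v \in [seq v <- s | v \in F] -> affine_eval h v = 0.
  by rewrite mem_filter => /andP[/set_mem]; rewrite FE => -[].
rewrite FE; split.
  by apply: conv_mono cx => v /=; rewrite mem_filter => /andP[].
case: cx => n [y [c [ys _ c1 ->]]] /=; rewrite affine_eval_sum // big1 // => i _.
by rewrite sF ?mulr0 //; apply: ys.
Qed.

Lemma face_eq d (s : seq 'rV[R]_d) F G : face (conv [set` s]) F ->
  face (conv [set` s]) G -> (forall v, v \in s -> F v <-> G v) -> F = G.
Proof.
move=> fF fG FG; rewrite (face_conv_gens fF) (face_conv_gens fG).
have -> // : [seq v <- s | v \in F] = [seq v <- s | v \in G].
apply: eq_in_filter => v /FG[FGv GFv].
by apply/idP/idP => /set_mem ?; apply/mem_set; auto.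
Qed.

Lemma finite_faces d (s : seq 'rV[R]_d) : finite_set (face (conv [set` s])).
Proof.
pose f (m : (size s).-tuple bool) := conv [set` mask m s].
apply: (@sub_finite_set _ _ (f @` [set: (size s).-tuple bool])); last first.
  exact/finite_image/finite_finset.
move=> F fF; exists (map_tuple (fun v => v \in F) (in_tuple s)) => //.
by rewrite /f /= -filter_mask -face_conv_gens.
Qed.

End Faces.

(** * Faces of the vertex split *)

Section VertexSplit.
Context {R : realType}.
Variables (d : nat) (P : set 'rV[R]_d) (p : 'rV[R]_d) (V : seq 'rV[R]_d).
Hypothesis PE : P = conv [set` V].
Hypothesis VE : vertex P = [set` V].
Hypothesis fullP : full_dimensional P.
Hypothesis hp : vertex P p.

Let Q := vertex_split P p.

Definition sgn_of (b : bool) : R := if b then 1 else -1.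

Definition split_point b (w : 'rV[R]_d) : 'rV[R]_(d + 1) :=
  row_mx w (if w == p then const_mx (sgn_of b) else 0).

Definition base (h : 'cV[R]_(d + 1) * R) : 'cV[R]_d * R := (usubmx h.1, h.2).
Definition slope (h : 'cV[R]_(d + 1) * R) : R := dsubmx h.1 0 0.
Definition with_slope (g : 'cV[R]_d * R) (c : R) : 'cV[R]_(d + 1) * R :=
  (col_mx g.1 c%:M, g.2).

Lemma base_with_slope g c : base (with_slope g c) = g.
Proof. by case: g => g1 g2; rewrite /base /with_slope /= col_mxKu. Qed.

Lemma slope_with_slope g c : slope (with_slope g c) = c.
Proof. by rewrite /slope /with_slope /= col_mxKd mxE eqxx. Qed.

Lemma with_slopeK h : with_slope (base h) (slope h) = h.
Proof.
case: h => h1 h2; rewrite /with_slope /base /slope /=; congr (_, _).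
by rewrite -[RHS]vsubmxK; congr col_mx; rewrite [RHS]mx11_scalar.
Qed.

Lemma split_eval h b w : affine_eval h (split_point b w) =
  affine_eval (base h) w + (if w == p then sgn_of b * slope h else 0).
Proof.
rewrite /affine_eval /split_point /base /slope /= -{1}[h.1]vsubmxK mul_row_col.
rewrite [in LHS]mxE -!addrA; congr (_ + _); rewrite addrC; congr (_ + _).
by case: eqP => _; rewrite mxE big_ord1 mxE ?mul0r.
Qed.

Lemma mem_p : p \in V.
Proof. by have : [set` V] p by rewrite -VE. Qed.

Definition split_gens : seq 'rV[R]_(d + 1) :=
  map (split_point true) V ++ [:: split_point false p].

Lemma split_gensP y : reflect (exists b w, w \in V /\ y = split_point b w)
  (y \in split_gens).
Proof.
apply: (iffP idP); rewrite mem_cat mem_seq1.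
  move=> /orP[/mapP[w wV ->]|/eqP ->]; first by exists true, w.
  by exists false, p; rewrite mem_p.
move=> [b [w [wV ->]]]; case: b; first by rewrite map_f.
have [->|wp] := eqVneq w p; first by rewrite eqxx orbT.
by apply/orP; left; apply/mapP; exists w => //; rewrite /split_point (negPf wp).
Qed.

Lemma vertex_splitE : Q = conv [set` split_gens].
Proof.
rewrite /Q /vertex_split; congr conv; apply/seteqP; split=> y /=.
  move=> [[w [wV wp] <-]|[->|->]]; apply/split_gensP.
  - exists true, w; split; first by move: wV; rewrite VE.
    by rewrite /split_point; case: eqP => [/wp|].
  - by exists true, p; rewrite mem_p /split_point eqxx.
  - by exists false, p; rewrite mem_p /split_point eqxx.
move=> /split_gensP[b [w [wV ->]]]; rewrite /split_point.
have [->|wp] := eqVneq w p; last first.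
  left; exists w => //; split; first by rewrite VE.
  by move=> /= wpE; move: wp; rewrite wpE eqxx.
by right; rewrite /sgn_of; case: b; [left|right].
Qed.

Lemma split_point_inj b b' w w' : split_point b w = split_point b' w' ->
  w = w' /\ (w = p -> b = b').
Proof.
have N1 : 1 <> -1 :> R by lra.
rewrite /split_point => /eq_row_mx[<- H]; split=> // wp; move: H.
rewrite wp eqxx => /matrixP/(_ 0 0); rewrite !mxE.
by case: b b' => [] []; rewrite /sgn_of //= => E; case: N1.
Qed.

Lemma split_point_eq b b' w : w != p -> split_point b w = split_point b' w.
Proof. by rewrite /split_point => /negPf ->. Qed.

Lemma vertexV v : v \in V -> vertex P v.
Proof. by move=> vV; rewrite VE. Qed.

Lemma memV v : v \in V -> P v.
Proof. by move=> /vertexV /vertex_sub. Qed.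

Lemma vertex_vertex_split : vertex Q = [set` split_gens].
Proof.
apply/seteqP; split=> [y|y /=]; first by rewrite vertex_splitE => /vertex_in_gens.
move=> yG; rewrite vertex_splitE; move: (yG) => /split_gensP[b [w [wV yE]]].
have [h [hw h0 hpos]] := vertex_functional (vertexV wV).
(* At a copy of [p], the function [h + 1] minus the signed height is 0 at that copy, 2 at the other,
   and at least 1 at every other vertex, whose height is 0. For the remaining vertices [h] itself,
   constant in the new direction, suffices. *)
pose g : 'cV[R]_(d + 1) * R :=
  if w == p then with_slope (h.1, h.2 + 1) (- sgn_of b) else with_slope h 0.
have b1 : sgn_of b * sgn_of b = 1 by rewrite /sgn_of; case: b {yE g}; ring.
apply: (@vertex_of_gens _ _ _ _ g) => //.
  rewrite yE split_eval /g; case: (eqVneq w p) => [wp|wp].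
    rewrite base_with_slope slope_with_slope mulrN b1.
    by rewrite /affine_eval /= addrA -/(affine_eval h w) hw; ring.
  by rewrite base_with_slope hw addr0.
move=> z /= /split_gensP[b' [w' [wV' ->]]]; rewrite yE => zy.
rewrite split_eval /g; case: (eqVneq w p) => [wp|wp]; last first.
  rewrite base_with_slope slope_with_slope mulr0.
  rewrite (_ : (if _ then _ else _) = 0); last by case: ifP.
  rewrite addr0; apply: hpos; first exact: memV.
  by apply: contra_neq zy => ->; apply: split_point_eq.
rewrite base_with_slope slope_with_slope.
have -> : affine_eval (h.1, h.2 + 1) w' = affine_eval h w' + 1.
  by rewrite /affine_eval /= addrA.
have := h0 _ (memV wV'); case: eqP => [wp'|_]; last by lra.
move: zy; rewrite wp' wp /sgn_of; case: b b' {yE b1 g} => [] [];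
  rewrite ?eqxx // => _; lra.
Qed.

Lemma affine_of0 n : @affine_of R n 0 = (0, 0).
Proof.
by rewrite /affine_of; congr (_, _); [apply/matrixP => i j|]; rewrite !mxE.
Qed.

Lemma functional0 n : @functional R n (0, 0) = 0.
Proof. by rewrite /functional /= raddf0 col_mx0. Qed.

Lemma full_vertex_split : full_dimensional Q.
Proof.
apply: full_dim_of_functionals => k Qk.
pose h := affine_of k.
have Qh b w : w \in V -> affine_eval h (split_point b w) = 0.
  move=> wV; rewrite affine_eval_of; apply: Qk; rewrite vertex_splitE.
  by apply: sub_conv; apply/split_gensP; exists b, w.
have := Qh true p mem_p; have := Qh false p mem_p.
rewrite !split_eval eqxx /sgn_of => e1 e2.
have s0 : slope h = 0 by lra.
have b0 : functional (base h) = 0.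
  apply: (full_dim_gens0 PE fullP) => v vV; have := Qh true v vV.
  rewrite split_eval s0 mulr0 -affine_evalE.
  by case: ifP => _; rewrite addr0.
have -> : k = functional h by rewrite affine_ofK.
have bE : base h = (0, 0).
  by rewrite -[LHS]functionalK b0 affine_of0.
rewrite -(with_slopeK h) s0 bE /with_slope /= raddf0 col_mx0.
exact: functional0.
Qed.

(* The functional of the facet of [Q] lying over [{g = 0}] and containing the
   copy of [p] with sign [~~ b]. *)
Definition tilt b (g : 'cV[R]_d * R) := with_slope g (sgn_of b * affine_eval g p).

Lemma sgn_ofN b : sgn_of (~~ b) = - sgn_of b.
Proof. by case: b; rewrite /sgn_of //= opprK. Qed.

Lemma sgn_of_sqr b : sgn_of b * sgn_of b = 1.
Proof. by case: b; rewrite /sgn_of; ring. Qed.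

Lemma tilt_eval b b' g w : affine_eval (tilt b g) (split_point b' w) =
  affine_eval g w + (if w == p then sgn_of b' * (sgn_of b * affine_eval g p) else 0).
Proof. by rewrite split_eval base_with_slope slope_with_slope. Qed.

(** The point is that the factor is positive: on the copy of sign [b], the tilted functional has the
    signs and zeros of [g]. *)
Lemma tilt_eval_same b g w : affine_eval (tilt b g) (split_point b w) =
  affine_eval g w *+ (if w == p then 2 else 1).
Proof.
rewrite tilt_eval mulrA sgn_of_sqr mul1r.
by case: eqP => [->|_]; rewrite ?addr0 // mulr2n.
Qed.

Lemma tilt_eval_opp b g : affine_eval (tilt b g) (split_point (~~ b) p) = 0.
Proof. by rewrite tilt_eval eqxx mulrA sgn_ofN mulNr sgn_of_sqr; ring. Qed.

Lemma split_point_same b b' w : ~ (w = p /\ b' = ~~ b) ->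
  split_point b' w = split_point b w.
Proof.
have [wp|wp] := eqVneq w p; last by move=> _; apply: split_point_eq.
by move=> N; congr split_point; case: b b' N => [] [] // [].
Qed.

Lemma tilt_ge0 b g : (forall x, P x -> 0 <= affine_eval g x) ->
  forall y, Q y -> 0 <= affine_eval (tilt b g) y.
Proof.
move=> g0 y; rewrite vertex_splitE => /conv_ge0; apply => {}y /=.
move=> /split_gensP[b' [w [wV ->]]].
have [[-> ->]|] := pselect (w = p /\ b' = ~~ b); first by rewrite tilt_eval_opp.
move=> /split_point_same ->.
by rewrite tilt_eval_same mulrn_wge0 // g0 //; apply: memV.
Qed.

Definition lift_face b F : set 'rV[R]_(d + 1) :=
  Q `&` [set y | affine_eval (tilt b (facet_ineq P F)) y = 0].

Lemma facet_ineqP F : face P F -> cuts_face P (facet_ineq P F) F.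
Proof. exact: (xgetPex (0, 0)). Qed.

Lemma cuts_face_mem n (S : set 'rV[R]_n) h F w :
  cuts_face S h F -> S w -> F w <-> affine_eval h w = 0.
Proof. by move=> [_ ->] Sw; split=> [[]|hw]. Qed.

Lemma lift_face_cuts b F : face P F ->
  cuts_face Q (tilt b (facet_ineq P F)) (lift_face b F).
Proof. by move=> /facet_ineqP[h0 _]; split=> // y Qy; apply: tilt_ge0. Qed.

Lemma split_point_mem b w : w \in V -> Q (split_point b w).
Proof.
by move=> wV; rewrite vertex_splitE; apply: sub_conv; apply/split_gensP; exists b, w.
Qed.

Lemma lift_face_same b F w : face P F -> w \in V ->
  lift_face b F (split_point b w) <-> F w.
Proof.
move=> fF wV; rewrite (cuts_face_mem (facet_ineqP fF) (memV wV)).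
split=> [[_ /=]|hw]; last first.
  by split; [exact: split_point_mem|rewrite /= tilt_eval_same hw mul0rn].
rewrite tilt_eval_same => /eqP; case: (w == p); last by move/eqP.
by rewrite mulrn_eq0 => /eqP.
Qed.

Lemma lift_face_opp b F : lift_face b F (split_point (~~ b) p).
Proof. by split; [apply: split_point_mem mem_p|rewrite /= tilt_eval_opp]. Qed.

Lemma lift_face_indep b b' F : face P F -> F p -> lift_face b F = lift_face b' F.
Proof.
move=> fF Fp; rewrite /lift_face /tilt.
have -> : affine_eval (facet_ineq P F) p = 0.
  exact/(cuts_face_mem (facet_ineqP fF) (memV mem_p)).
by rewrite !mulr0.
Qed.

Lemma face_gens0 F g : face P F -> (forall w, w \in V -> F w -> affine_eval g w = 0) ->
  forall x, F x -> lin_eval (functional g) (homogenize x) = 0.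
Proof.
move=> fF g0 x Fx; rewrite -affine_evalE; move: fF Fx; rewrite PE => fF Fx.
move: Fx; rewrite (face_conv_gens fF) => -[n [y [c [yF _ c1 ->]]]].
rewrite affine_eval_sum // big1 // => i _.
have /= := yF i; rewrite mem_filter => /andP[/set_mem Fy yV].
by rewrite g0 ?mulr0.
Qed.

Definition scale_affine n a (g : 'cV[R]_n * R) : 'cV[R]_n * R := (a *: g.1, a * g.2).

Lemma functional_scale n a (g : 'cV[R]_n * R) :
  functional (scale_affine a g) = a *: functional g.
Proof. by rewrite /functional /= scale_col_mx scale_scalar_mx. Qed.

Lemma affine_eval_scale n a g (x : 'rV[R]_n) :
  affine_eval (scale_affine a g) x = a * affine_eval g x.
Proof. by rewrite !affine_evalE functional_scale lin_evalZl. Qed.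

Lemma functional_scaleI n a (g g' : 'cV[R]_n * R) :
  functional g' = a *: functional g -> g' = scale_affine a g.
Proof. by rewrite -functional_scale => /(can_inj (@functionalK _ _)). Qed.

Lemma tilt_scale b a g : tilt b (scale_affine a g) = scale_affine a (tilt b g).
Proof.
rewrite /tilt /with_slope affine_eval_scale /scale_affine /=; congr (_, _).
by rewrite scale_col_mx scale_scalar_mx mulrCA.
Qed.

(** Vanishing at one copy of [p] determines the slope from the value of the base at [p]. *)
Lemma tilt_base b h : affine_eval h (split_point (~~ b) p) = 0 ->
  h = tilt b (base h).
Proof.
rewrite split_eval eqxx sgn_ofN => h0; rewrite -{1}(with_slopeK h) /tilt.
congr with_slope; have := sgn_of_sqr b; have := congr1 ( *%R (sgn_of b)) h0.
by rewrite mulr0 mulrDr mulNr mulrN mulrA => /eqP; rewrite subr_eq0 => /eqP -> ->;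
  rewrite mul1r.
Qed.

Lemma tilt_neq0 b g : functional g != 0 -> functional (tilt b g) != 0.
Proof.
apply: contra_neq => g0.
have -> : g = base (tilt b g) by rewrite base_with_slope.
rewrite -(functionalK (tilt b g)) g0 affine_of0 /base /=.
rewrite (_ : usubmx 0 = 0) ?functional0 //.
by apply/matrixP => i j; rewrite !mxE.
Qed.

Lemma facet_neq0 F g : facet P F -> cuts_face P g F -> functional g != 0.
Proof. by move=> [_ dF] cF; apply: functional_neq0 cF _; rewrite // -dF. Qed.

(** The lifted face contains the copy of [p] of sign [~~ b], so a functional vanishing on it is the
    tilt of its base. The base vanishes on [F], hence is a multiple of the facet functional, and
    tilting respects multiples. *)
Lemma lift_face_facet b F : facet P F -> facet Q (lift_face b F).
Proof.
move=> fF; have cF := facet_ineqP fF.1; set g := facet_ineq P F in cF.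
apply: (facet_of_functionals full_vertex_split _ (lift_face_cuts b fF.1)).
  exact/tilt_neq0/(facet_neq0 fF cF).
move=> k k0; pose h := affine_of k.
have h0 y : lift_face b F y -> affine_eval h y = 0.
  by rewrite affine_eval_of; apply: k0.
have hE := tilt_base (h0 _ (lift_face_opp b F)).
have [a aE] : exists a, functional (base h) = a *: functional g.
  apply: (facet_functionals fullP fF cF); apply: (face_gens0 fF.1) => w wV Fw.
  have := h0 _ ((lift_face_same b fF.1 wV).2 Fw).
  rewrite split_eval; case: (eqVneq w p) => [wp|]; last by rewrite addr0.
  have := h0 _ (lift_face_opp b F); rewrite split_eval eqxx wp sgn_ofN => *.
  lra.
exists a; rewrite -[k]affine_ofK -/h hE (functional_scaleI aE) tilt_scale.
by rewrite functional_scale.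
Qed.

(** If the facet missed both copies of [p], all its generators would have height 0, making the
    height function [with_slope (0, 0) 1] a multiple of [h]. But the height has opposite signs at
    the two copies, while [h] is nonnegative at both. *)
Lemma split_facet_form G : facet Q G -> exists b g, cuts_face Q (tilt b g) G.
Proof.
move=> fG; have [h ch] := fG.1; have [h0 GE] := ch.
suff [b hb] : exists b, affine_eval h (split_point (~~ b) p) = 0.
  by exists b, (base h); rewrite -(tilt_base hb).
apply: contrapT => N.
have hN b : affine_eval h (split_point b p) != 0.
  by apply/eqP => hb; apply: N; exists (~~ b); rewrite negbK.
have [a aE] : exists a, functional (with_slope (0, 0) 1) = a *: functional h.
  apply: (facet_functionals full_vertex_split fG ch) => x Gx.
  rewrite -affine_evalE; move: fG.1 Gx; rewrite vertex_splitE => fG' Gx.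
  move: Gx; rewrite (face_conv_gens fG') => -[n [y [c [yG _ c1 ->]]]].
  rewrite affine_eval_sum // big1 // => i _.
  have /= := yG i; rewrite mem_filter => /andP[/set_mem Gy /split_gensP[b [w [wV yE]]]].
  rewrite yE split_eval base_with_slope slope_with_slope.
  have wp : w != p.
    apply/eqP => wp; move: (hN b); rewrite -wp -yE.
    by move: Gy; rewrite GE => -[_ /= ->]; rewrite eqxx.
  by rewrite (negPf wp) /affine_eval mulmx0 mxE !addr0 mulr0.
have := functional_scaleI aE => hE.
have ev b : sgn_of b = a * affine_eval h (split_point b p).
  rewrite -affine_eval_scale -hE split_eval base_with_slope slope_with_slope eqxx.
  by rewrite mulr1 /affine_eval mulmx0 mxE !addr0 add0r.
have e1 := ev true; have e2 := ev false.
have p1 : 0 <= affine_eval h (split_point true p) by apply/h0/split_point_mem/mem_p.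
have p2 : 0 <= affine_eval h (split_point false p) by apply/h0/split_point_mem/mem_p.
rewrite /sgn_of in e1 e2.
have [a0|a0] := leP 0 a.
  by have := mulr_ge0 a0 p2; lra.
by have := mulr_le0_ge0 (ltW a0) p1; lra.
Qed.

Lemma split_facetP G : facet Q G -> exists b F, facet P F /\ G = lift_face b F.
Proof.
move=> fG; have [b [g cG]] := split_facet_form fG; have [g0 GE] := cG.
have gE w : affine_eval (tilt b g) (split_point b w) =
    affine_eval g w *+ (if w == p then 2 else 1) by rewrite tilt_eval_same.
have gz w : affine_eval (tilt b g) (split_point b w) = 0 <-> affine_eval g w = 0.
  rewrite gE; split=> [/eqP|->]; last by rewrite mul0rn.
  by rewrite mulrn_eq0; case: (w == p) => /= /eqP.
pose F := P `&` [set x | affine_eval g x = 0].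
have cF : cuts_face P g F.
  split=> // x; rewrite PE => /conv_ge0; apply => {}x /= xV.
  have := g0 _ (split_point_mem b xV); rewrite gE.
  by case: (x == p); rewrite ?pmulrn_lge0.
have tN0 : functional (tilt b g) != 0.
  by apply: functional_neq0 full_vertex_split cG _; rewrite -fG.2.
have gN0 : functional g != 0.
  apply: contra_neq tN0 => g00.
  have -> : g = scale_affine 0 g by apply: functional_scaleI; rewrite g00 scale0r.
  by rewrite tilt_scale functional_scale scale0r.
have fF : facet P F.
  (* A functional vanishing on [F] is tilted so as to vanish on [G]; there it is a multiple of the
     tilt of [g], and passing to bases gives the same multiple of [g]. *)
  apply: (facet_of_functionals fullP gN0 cF) => k k0.
  pose h := affine_of k.
  have hF w : w \in V -> affine_eval g w = 0 -> affine_eval h w = 0.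
    by move=> wV gw; rewrite affine_eval_of; apply: k0; split=> //; apply: memV.
  have [a aE] : exists a, functional (tilt b h) = a *: functional (tilt b g).
    apply: (facet_functionals full_vertex_split fG cG) => x Gx.
    rewrite -affine_evalE; move: fG.1 Gx; rewrite vertex_splitE => fG' Gx.
    move: Gx; rewrite (face_conv_gens fG') => -[n [y [c [yG _ c1 ->]]]].
    rewrite affine_eval_sum // big1 // => i _.
    have /= := yG i; rewrite mem_filter => /andP[/set_mem Gy].
    move=> /split_gensP[b' [w [wV yE]]]; rewrite yE.
    have [[-> ->]|N] := pselect (w = p /\ b' = ~~ b).
      by rewrite tilt_eval_opp mulr0.
    have E := split_point_same N.
    rewrite E tilt_eval_same hF ?mul0rn ?mulr0 //; apply/gz.
    by move: Gy; rewrite yE E GE => -[].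
  exists a; rewrite -[k]affine_ofK -/h -(base_with_slope h (sgn_of b * affine_eval h p)).
  rewrite -/(tilt b h) (functional_scaleI aE) -tilt_scale base_with_slope.
  exact: functional_scale.
(* [lift_face] is built from the chosen [facet_ineq P F], not from [g], so the two faces are
   compared on generators. *)
exists b, F; split=> //; have fQG := fG.1; have fQL := (lift_face_facet b fF).1.
move: (fQG) (fQL); rewrite {1 2}vertex_splitE => fG' fL'.
apply: (face_eq fG' fL') => y /split_gensP[b' [w [wV ->]]].
have [[-> ->]|N] := pselect (w = p /\ b' = ~~ b).
  split=> _; first exact: lift_face_opp.
  by rewrite GE; split; [apply: split_point_mem mem_p|rewrite /= tilt_eval_opp].
rewrite (split_point_same N).
rewrite (lift_face_same b fF.1 wV) (cuts_face_mem cG (split_point_mem b wV)).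
by rewrite gz (cuts_face_mem cF (memV wV)).
Qed.

(** [facet_span] is applied to the constant function 1, which has no zeros: if all facet functionals
    vanished at [p], so would this constant. *)
Lemma facet_avoiding : exists2 F, facet P F & ~ F p.
Proof.
apply: contrapT => N.
have : lin_eval (functional ((0, 1) : 'cV[R]_d * R)) (homogenize p) = 0.
  apply: (facet_span PE fullP) => [v _|F h fF cF _].
    by rewrite -affine_evalE /affine_eval mulmx0 mxE add0r ler01.
  rewrite -affine_evalE; apply/(cuts_face_mem cF (memV mem_p)).
  by apply: contrapT => Fp; apply: N; exists F.
by rewrite -affine_evalE /affine_eval mulmx0 mxE add0r => /eqP; rewrite oner_eq0.
Qed.

End VertexSplit.

(** * Vertex sums *)

Section Summand.
Context {R : realType}.
Variables (a d : nat) (A : 'M[R]_(a, d)) (p : 'rV[R]_d) (W V : seq 'rV[R]_d).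
Hypothesis fA : row_free A.
Hypothesis WA : forall w, w \in W -> (w - p <= A)%MS.
Hypothesis AW : forall k : 'cV[R]_d, (forall w, w \in W -> lin_eval k (w - p) = 0) ->
  A *m k = 0.
Hypothesis WV : forall w, w \in p :: W -> w \in V.
Hypothesis hp : vertex (conv [set` V]) p.

(** Coordinates with origin [p] along the rows of [A]; since [A] is row free, they are faithful on
    the affine subspace through [p] in the row space of [A]. *)
Definition summand_coord (w : 'rV[R]_d) : 'rV[R]_a := (w - p) *m pinvmx A.
Definition summand : set 'rV[R]_a := conv [set` map summand_coord (p :: W)].
Definition summand_map (x : 'rV[R]_a) : 'rV[R]_d := x *m A + p.

Lemma summand_coordK w : w \in p :: W -> summand_map (summand_coord w) = w.
Proof.
rewrite in_cons /summand_map /summand_coord => /orP[/eqP ->|/WA wA].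
  by rewrite subrr !mul0mx add0r.
by rewrite mulmxKpV // subrK.
Qed.

Lemma summand_coord_p : summand_coord p = 0.
Proof. by rewrite /summand_coord subrr mul0mx. Qed.

Lemma summand_polytope : polytope summand.
Proof. by eexists. Qed.

Lemma affine_eval_summand h x :
  affine_eval (A *m h.1, affine_eval h p) x = affine_eval h (summand_map x).
Proof. by rewrite /affine_eval /summand_map /= mulmxDl mulmxA [X in _ = X + _]mxE addrA. Qed.

Lemma summand_map_sub x : summand x -> conv [set` V] (summand_map x).
Proof.
move=> Qx; apply: conv_finite => h hV; rewrite -affine_eval_summand.
apply: (conv_ge0 Qx) => y yQ.
have /mapP[w wW ->] : y \in map summand_coord (p :: W) by exact: yQ.
by rewrite affine_eval_summand summand_coordK // hV // WV.
Qed.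

Lemma summand_gen w : w \in p :: W -> (summand_map @` summand) w.
Proof.
move=> wW; exists (summand_coord w); last exact: summand_coordK.
by apply: sub_conv; exact: (map_f summand_coord wW).
Qed.

Lemma summand_full : full_dimensional summand.
Proof.
apply: full_dim_of_functionals => k Qk; pose h := affine_of k.
have hW w : w \in p :: W -> affine_eval h (summand_coord w) = 0.
  move=> wW; rewrite affine_eval_of; apply: Qk; apply: sub_conv.
  exact: (map_f summand_coord wW).
have h2 : h.2 = 0.
  have := hW p (mem_head _ _).
  by rewrite summand_coord_p /affine_eval mul0mx mxE add0r.
have h1 : h.1 = 0.
  have : A *m (pinvmx A *m h.1) = 0.
    apply: AW => w wW; have := hW w; rewrite in_cons wW orbT => /(_ isT).
    by rewrite /affine_eval h2 addr0 /summand_coord -mulmxA.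
  by rewrite (mulmxA A (pinvmx A)) mulmxVp // mul1mx.
by rewrite -[k]affine_ofK -/h /functional h1 h2 raddf0 col_mx0.
Qed.

Lemma summand_vertex : vertex summand 0.
Proof.
have [h [hpz _ hpos]] := vertex_functional hp.
apply: (@vertex_of_gens _ _ _ _ (A *m h.1, affine_eval h p)).
- by rewrite -summand_coord_p; exact: (map_f summand_coord (mem_head p W)).
- by rewrite affine_eval_summand /summand_map mul0mx add0r.
move=> y yQ; have /mapP[w wW ->] : y \in map summand_coord (p :: W) by exact: yQ.
move=> w0.
rewrite affine_eval_summand summand_coordK //; apply: hpos.
  by apply: sub_conv; apply: WV.
by apply: contra_neq w0 => ->; apply: summand_coord_p.
Qed.

Lemma aff_summand x : aff (summand_map @` summand) x -> (x - p <= A)%MS.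
Proof.
move=> [n [y [c [yQ c1 ->]]]].
rewrite -[p]scale1r -c1 scaler_suml -sumrB; apply: summx_sub => i _.
have [z _ <-] := yQ i.
by rewrite -scalerBr addrK scalemx_sub // submxMl.
Qed.

End Summand.

Section VertexSum.
Context {R : realType}.

(** The two summands have their common vertex at the origin of their own coordinates, and embedding
    them back gives the given hull exactly, so the combinatorial equivalence is the identity. The
    equation for [d] is a hypothesis because [a] and [b] will be ranks. *)
Lemma vertex_sum_intro d a b (A : 'M[R]_(a, d)) (B : 'M[R]_(b, d)) p
    (W1 W2 V : seq 'rV[R]_d) : d = (a + b)%N -> (0 < a)%N -> (0 < b)%N ->
  row_free A -> row_free B -> (A :&: B)%MS = 0 ->
  (forall w, w \in W1 -> (w - p <= A)%MS) ->
  (forall w, w \in W2 -> (w - p <= B)%MS) ->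
  (forall k : 'cV[R]_d, (forall w, w \in W1 -> lin_eval k (w - p) = 0) -> A *m k = 0) ->
  (forall k : 'cV[R]_d, (forall w, w \in W2 -> lin_eval k (w - p) = 0) -> B *m k = 0) ->
  (forall w, w \in p :: W1 -> w \in V) -> (forall w, w \in p :: W2 -> w \in V) ->
  (forall w, w \in V -> (w \in p :: W1) || (w \in p :: W2)) ->
  vertex (conv [set` V]) p ->
  comb_vertex_sum_at (conv [set` V]) p.
Proof.
move=> dE; subst d => a0 b0 fA fB AB WA WB AW BW W1V W2V VW hp.
exists a, b, (summand A p W1), 0, (summand B p W2), 0, (conv [set` V]), p.
split=> //.
- split; [exact: summand_polytope|exact: summand_full|exact: (summand_vertex (V := V))].
- split; [exact: summand_polytope|exact: summand_full|exact: (summand_vertex (V := V))].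
- exists A, p, B, p => /=; split=> //.
  + by rewrite !mul0mx !add0r.
  + apply/seteqP; split=> x.
      move=> [/aff_summand xA /aff_summand xB].
      have : (x - p <= A :&: B)%MS by rewrite sub_capmx xA xB.
      by rewrite AB submx0 subr_eq0 => /eqP.
    move=> ->; split; exists 1%N, (fun=> p), (fun=> 1); split=> //;
      rewrite ?big_ord1 ?scale1r // => _; apply: summand_gen => //; exact: mem_head.
  + apply/seteqP; split.
      apply: conv_mono => w /= /VW /orP[wW|wW]; [left|right]; exact: summand_gen.
    apply: conv_sub_finite => _ [[x Qx <-]|[x Qx <-]]; exact: (summand_map_sub (V := V)) Qx.
- exists id; split=> //; split=> //.
  by move=> F fF; exists F.
Qed.

Lemma exists_eps (T : eqType) (s : seq T) (f g : T -> R) :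
  (forall v, v \in s -> 0 < f v) ->
  exists2 e, 0 < e & forall v, v \in s -> 0 <= f v + e * g v.
Proof.
elim: s => [|x s IH] fs; first by exists 1.
have [|e e0 es] := IH; first by move=> v vs; apply: fs; rewrite in_cons vs orbT.
have fx : 0 < f x by apply: fs; apply: mem_head.
have g1 : 0 < 1 + `|g x| by rewrite ltr_pwDl.
(* The summand 1 keeps the denominator positive when [g x] is zero. *)
exists (Num.min e (f x / (1 + `|g x|))); first by rewrite lt_min e0 divr_gt0.
have m0 : 0 <= Num.min e (f x / (1 + `|g x|)) by rewrite le_min (ltW e0) divr_ge0 // ltW.
move=> v; rewrite in_cons => /orP[/eqP ->|vs].
  have : Num.min e (f x / (1 + `|g x|)) * `|g x| <= f x.
    apply: le_trans (_ : f x / (1 + `|g x|) * (1 + `|g x|) <= _).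
      apply: ler_pM => //; first by rewrite ge_min lexx orbT.
      by rewrite lerDr.
    by rewrite divfK // gt_eqF.
  move: m0; set m := Num.min _ _ => m0 H.
  have : - (m * `|g x|) <= m * g x.
    by rewrite -mulrN ler_wpM2l // lerNl ler_normr lexx orbT.
  lra.
have [gv|gv] := leP 0 (g v).
  by apply: addr_ge0; [apply/ltW/fs; rewrite in_cons vs orbT|apply: mulr_ge0].
apply: le_trans (es v vs) _; rewrite lerD2l ler_wnM2r // ?(ltW gv) //.
by rewrite ge_min lexx.
Qed.

(** * A disconnected common subgraph yields a vertex sum *)

Section Disconnected.
Variables (d : nat) (P : set 'rV[R]_d) (p : 'rV[R]_d) (V : seq 'rV[R]_d).
Hypothesis PE : P = conv [set` V].
Hypothesis VE : vertex P = [set` V].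
Hypothesis fullP : full_dimensional P.
Hypothesis hp : vertex P p.

(* The functionals supporting [P] at [p] span all functionals vanishing at [p]. *)
Lemma vertex_cone_pointed (u : 'rV[R]_d) :
  (forall F h, facet P F -> F p -> cuts_face P h F -> lin_eval h.1 u = 0) -> u = 0.
Proof.
move=> Fu; have [h [hpz _ hpos]] := vertex_functional hp.
have key (k : 'cV[R]_d * R) : affine_eval k p = 0 ->
    (forall v, v \in V -> 0 <= affine_eval k v) -> lin_eval k.1 u = 0.
  move=> kp kV.
  have uE (l : 'cV[R]_d * R) : lin_eval (functional l) (row_mx u 0) = lin_eval l.1 u.
    by rewrite /lin_eval mul_row_col mul0mx addr0.
  rewrite -uE; apply: (facet_span PE fullP).
    by move=> v vV; rewrite -affine_evalE; apply: kV.
  move=> F l fF cF Fz; rewrite uE; apply: (Fu F) => //; apply: Fz.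
    by have : [set` V] p by rewrite -VE.
  by rewrite -affine_evalE.
have VP v : v \in V -> P v by move=> vV; apply: vertex_sub; rewrite VE.
(* Each coordinate form is a multiple of a difference of supporting forms: [h] is strictly positive
   at the other vertices, so adding a small multiple of [l], corrected to vanish at [p], still
   supports [P] at [p]. Both forms kill [u], hence so does [l]. *)
apply/rowP => j; rewrite mxE; pose l : 'cV[R]_d := delta_mx j 0.
have -> : u 0 j = lin_eval l u by rewrite /lin_eval -colE mxE.
have [|e e0 He] := @exists_eps _ [seq v <- V | v != p] (affine_eval h)
    (fun v => lin_eval l (v - p)).
  by move=> v; rewrite mem_filter => /andP[vp vV]; apply: hpos => //; apply: VP.
pose k : 'cV[R]_d * R := (h.1 + e *: l, h.2 - e * lin_eval l p).
have kE v : affine_eval k v = affine_eval h v + e * lin_eval l (v - p).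
  by rewrite lin_evalB /affine_eval /k /= mulmxDr -scalemxAr mxE [X in _ + X + _ = _]mxE
     -/(lin_eval l v); ring.
have e1 : lin_eval k.1 u = 0.
  apply: key; first by rewrite kE hpz subrr /lin_eval mul0mx mxE mulr0 addr0.
  move=> v vV; rewrite kE; have [->|vp] := eqVneq v p.
    by rewrite hpz subrr /lin_eval mul0mx mxE mulr0 addr0.
  by apply: He; rewrite mem_filter vp.
have e2 : lin_eval h.1 u = 0.
  apply: key => // v vV; have [->|vp] := eqVneq v p; first by rewrite hpz.
  by apply/ltW/hpos => //; apply: VP.
move: e1; rewrite /k /= -[e *: l]opprK lin_evalBl e2 sub0r -scaleNr lin_evalZl.
by move/eqP; rewrite mulNr opprK mulf_eq0 gt_eqF //= => /eqP.
Qed.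

Definition edge_matrix (W : seq 'rV[R]_d) : 'M[R]_(size W, d) := \matrix_i (W`_i - p).

Lemma edge_matrix_sub W w : w \in W -> (w - p <= edge_matrix W)%MS.
Proof.
move=> wW; have iW : (index w W < size W)%N by rewrite index_mem.
by rewrite (_ : w - p = row (Ordinal iW) (edge_matrix W)) ?row_sub // rowK /= nth_index.
Qed.

Lemma edge_matrix_mul W (k : 'cV[R]_d) :
  (forall w, w \in W -> lin_eval k (w - p) = 0) -> edge_matrix W *m k = 0.
Proof.
move=> Wk; apply/colP => i; rewrite [RHS]mxE -(Wk W`_i) ?mem_nth //.
by rewrite /lin_eval -(rowK (fun i => W`_i - p)) -row_mul [RHS]mxE.
Qed.

Lemma sub_mul0 m n (A : 'M[R]_(m, d)) (B : 'M[R]_(n, d)) (k : 'cV[R]_d) :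
  (A <= B)%MS -> B *m k = 0 -> A *m k = 0.
Proof. by move=> /submxP[D ->] Bk; rewrite -mulmxA Bk mulmx0. Qed.

(** The directions from [p] to the two classes of vertices span complementary subspaces. Every facet
    functional through [p] vanishes on one of them, hence on their intersection, which is zero by
    [vertex_cone_pointed]; the sum is everything because [P] is full-dimensional. *)
Lemma disconnected_vertex_sum (C : pred 'rV[R]_d) :
  (forall F, facet P F -> F p ->
     (forall w, w \in V -> w != p -> C w -> F w) \/
     (forall w, w \in V -> w != p -> ~~ C w -> F w)) ->
  (exists w, [/\ w \in V, w != p & C w]) ->
  (exists w, [/\ w \in V, w != p & ~~ C w]) ->
  comb_vertex_sum_at P p.
Proof.
move=> HC [w1 [w1V w1p Cw1]] [w2 [w2V w2p Cw2]].
pose W1 := [seq w <- V | (w != p) && C w].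
pose W2 := [seq w <- V | (w != p) && ~~ C w].
pose A := row_base (edge_matrix W1); pose B := row_base (edge_matrix W2).
have AE : (A :=: edge_matrix W1)%MS by apply: eq_row_base.
have BE : (B :=: edge_matrix W2)%MS by apply: eq_row_base.
have pV : p \in V by have : [set` V] p by rewrite -VE.
have AW k : (forall w, w \in W1 -> lin_eval k (w - p) = 0) -> A *m k = 0.
  by move=> /edge_matrix_mul; apply: sub_mul0; rewrite AE.
have BW k : (forall w, w \in W2 -> lin_eval k (w - p) = 0) -> B *m k = 0.
  by move=> /edge_matrix_mul; apply: sub_mul0; rewrite BE.
have WA w : w \in W1 -> (w - p <= A)%MS by rewrite AE; apply: edge_matrix_sub.
have WB w : w \in W2 -> (w - p <= B)%MS by rewrite BE; apply: edge_matrix_sub.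
have edge0 F h w : cuts_face P h F -> F p -> F w -> lin_eval h.1 (w - p) = 0.
  move=> [_ FE]; rewrite FE => -[_ /= hpz] [_ /= hw].
  by move: hpz hw; rewrite lin_evalB /affine_eval /lin_eval => *; lra.
have AB0 : (A :&: B)%MS = 0.
  apply/eqP; rewrite -submx0; apply/row_subP => i.
  have [uA uB] : (row i (A :&: B) <= A)%MS /\ (row i (A :&: B) <= B)%MS.
    by split; apply: submx_trans (row_sub _ _) _; [apply: capmxSl|apply: capmxSr].
  move: (row i _) uA uB => u uA uB; rewrite submx0; apply/eqP.
  apply: vertex_cone_pointed => F h fF Fp cF.
  have [HF|HF] := HC F fF Fp.
    rewrite /lin_eval (sub_mul0 uA) ?mxE //; apply: AW => w.
    rewrite mem_filter => /andP[/andP[wp Cw] wV]; apply: edge0 cF Fp _; exact: HF.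
  rewrite /lin_eval (sub_mul0 uB) ?mxE //; apply: BW => w.
  rewrite mem_filter => /andP[/andP[wp Cw] wV]; apply: edge0 cF Fp _; exact: HF.
(* A linear form killing both subspaces is constant on the vertices of [P], hence zero. *)
have ABd : \rank (A + B)%MS = d.
  have c0 : cokermx (A + B)%MS = 0.
    apply/matrixP => i j; rewrite [RHS]mxE.
    pose l := col j (cokermx (A + B)%MS).
    have ABl : (A + B)%MS *m l = 0 by rewrite /l colE mulmxA mulmx_coker mul0mx.
    have Al : A *m l = 0 by apply: sub_mul0 ABl; apply: addsmxSl.
    have Bl : B *m l = 0 by apply: sub_mul0 ABl; apply: addsmxSr.
    have lw w : w \in V -> lin_eval l (w - p) = 0.
      move=> wV; have [->|wp] := eqVneq w p.
        by rewrite subrr /lin_eval mul0mx mxE.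
      have [Cw|Cw] := boolP (C w).
        by rewrite /lin_eval (sub_mul0 (WA w _) Al) ?mxE // mem_filter wp Cw.
      by rewrite /lin_eval (sub_mul0 (WB w _) Bl) ?mxE // mem_filter wp Cw.
    have := @full_dim_gens0 _ _ _ _ PE fullP (functional (l, - lin_eval l p)).
    move=> lem; have {}lem := lem _.
    have l0 : functional (l, - lin_eval l p) = 0.
      apply: lem => w wV; rewrite -affine_evalE /affine_eval /=.
      by have := lw w wV; rewrite lin_evalB.
    have : l = 0.
      have := congr1 (@usubmx _ d 1 1) l0; rewrite /functional col_mxKu /= => ->.
      by apply/matrixP => s t; rewrite !mxE.
    by move/colP/(_ i); rewrite !mxE.
  have := mxrank_coker (A + B)%MS; rewrite c0 mxrank0.
  have := rank_leq_col (A + B)%MS; lia.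
rewrite PE; apply: (@vertex_sum_intro _ _ _ A B p W1 W2 V) => //.
- have := mxrank_sum_cap A B.
  by rewrite AB0 mxrank0 addn0 ABd AE BE.
- rewrite lt0n mxrank_eq0; apply/eqP => z.
  have : (w1 - p <= edge_matrix W1)%MS.
    by apply: edge_matrix_sub; rewrite mem_filter w1p Cw1.
  by rewrite z => /submx0null/eqP; rewrite subr_eq0 (negPf w1p).
- rewrite lt0n mxrank_eq0; apply/eqP => z.
  have : (w2 - p <= edge_matrix W2)%MS.
    by apply: edge_matrix_sub; rewrite mem_filter w2p Cw2.
  by rewrite z => /submx0null/eqP; rewrite subr_eq0 (negPf w2p).
- exact: row_base_free.
- exact: row_base_free.
- by move=> w; rewrite in_cons => /orP[/eqP -> //|]; rewrite mem_filter => /andP[].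
- by move=> w; rewrite in_cons => /orP[/eqP -> //|]; rewrite mem_filter => /andP[].
- move=> w wV; rewrite !in_cons !mem_filter wV !andbT.
  by case: eqP => //= _; case: (C w).
- by rewrite -PE.
Qed.

End Disconnected.
End VertexSum.

(** * Slack ideals of the vertex split *)

Section SlackPattern.
Context {R : realType} (K : fieldType).

Definition slack_pattern d (S : set 'rV[R]_d) (F : facetT S) (v : vertexT S) : bool :=
  slack F v != 0.

Lemma fset_setP (T : choiceType) (A : set T) : finite_set A ->
  forall x : fset_set A, A (val x).
Proof. by move=> fA x; have := valP x; rewrite in_fset_set // => /set_mem. Qed.

Lemma fset_set_elt (T : choiceType) (A : set T) (x : T) : finite_set A -> A x ->
  exists y : fset_set A, val y = x.
Proof.
move=> fA Ax; have xA : x \in fset_set A by rewrite in_fset_set // mem_set.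
by exists [` xA]%fset.
Qed.

Variables (d : nat) (S : set 'rV[R]_d).
Hypothesis pS : polytope S.

(** [fset_set] has the intended elements only for finite sets, so finiteness is what gives [facetT]
    its meaning. *)
Lemma finite_facets : finite_set (facet S).
Proof.
have [s ->] := pS; apply: sub_finite_set (finite_faces s) => F; exact: proj1.
Qed.

Lemma finite_vertices : finite_set (vertex S).
Proof. by have [s [_ ->]] := polytope_vertices pS. Qed.

Lemma facetT_facet (F : facetT S) : facet S (val F).
Proof. exact: (fset_setP finite_facets). Qed.

Lemma vertexT_vertex (v : vertexT S) : vertex S (val v).
Proof. exact: (fset_setP finite_vertices). Qed.

Lemma slack_patternE (F : facetT S) (v : vertexT S) :
  slack_pattern F v = (val v \notin val F).
Proof.
rewrite /slack_pattern /slack; congr (~~ _).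
have cF := facet_ineqP (facetT_facet F).1.
have [E1 E2] := cuts_face_mem cF (vertex_sub (vertexT_vertex v)).
by apply/eqP/idP => [/E2|/set_mem/E1 //] => Fv; apply/mem_set.
Qed.

Lemma nonincidence_adj : @nonincidence R d S = adj (@slack_pattern d S).
Proof.
by apply/funext => -[F|v]; apply/funext => -[G|w] //=; rewrite slack_patternE.
Qed.

Lemma slack_idealE : slack_ideal K S = minor_ideal K (@slack_pattern d S) (adim1 S).+1.
Proof. by []. Qed.

Lemma toric_idealE : toric_ideal K S = cycle_ideal K (@slack_pattern d S).
Proof. by rewrite /toric_ideal nonincidence_adj. Qed.

End SlackPattern.

Lemma facet_missing_vertex (R : realType) d (P : set 'rV[R]_d) (V : seq 'rV[R]_d) F :
  P = conv [set` V] -> facet P F -> exists2 w, w \in V & ~ F w.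
Proof.
move=> PE [fF dF]; apply: contrapT => N.
have FV w : w \in V -> F w by move=> wV; apply: contrapT => Fw; apply: N; exists w.
suff FP : F = P by move: dF; rewrite FP => /eqP; rewrite eqn_leq ltnn.
rewrite PE in fF; rewrite (face_conv_gens fF) PE.
have -> // : [seq v <- V | v \in F] = V.
by apply/all_filterP/allP => v /FV Fv; apply/mem_set.
Qed.

(** * Connectedness of the common subgraph *)

Section Connectivity.
Context {R : realType} (d : nat) (P : set 'rV[R]_d) (p : vertexT P).
Hypothesis pP : polytope P.
Hypothesis fullP : full_dimensional P.
Hypothesis no_sum : ~ comb_vertex_sum_at P (val p).

Let good (x : facetT P + vertexT P) :=
  match x with inl F => ~~ slack_pattern F p | inr v => v != p end.

Let e0 : rel (facetT P + vertexT P) :=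
  [rel x y | adj (@slack_pattern _ d P) x y && (good x && good y)].

(** Otherwise let [C] hold the vertices reachable from [x]. A reachable facet through [p] contains
    every vertex outside [C], and an unreachable one every vertex in [C], since a missed vertex
    would be adjacent. Both classes are nonempty because each facet through [p] misses some vertex,
    necessarily other than [p]; so [P] would be a vertex sum. *)
Lemma link_connected x y : good x -> good y ->
  exists q, [/\ path (adj (@slack_pattern _ d P)) x q, all good q & last x q = y].
Proof.
move=> gx gy; have [V [PE VE]] := polytope_vertices pP.
have hp := vertexT_vertex pP p.
have memV (v : vertexT P) : val v \in V.
  by move: (val v) (vertexT_vertex pP v) => w; rewrite VE.
have eltV w : w \in V -> exists v : vertexT P, val v = w.
  by move=> wV; apply: (fset_set_elt (finite_vertices pP)); rewrite VE.
have e0_sym : connect_sym e0.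
  by apply: sym_connect_sym => s t; congr (_ && _); [exact: adj_sym|exact: andbC].
have gp F : good (inl F) = (val p \in val F) by rewrite /= slack_patternE // negbK.
have e0E F v : good (inl F) -> v != p -> e0 (inl F) (inr v) = (val v \notin val F).
  by move=> gF vp; rewrite /e0 /= -/(good (inl F)) gF vp !andbT slack_patternE.
have reach z : good z -> exists2 v, v != p & connect e0 z (inr v).
  case: z => [F gF|v gv]; last by exists v.
  have [w wV nFw] := facet_missing_vertex PE (facetT_facet pP F).
  have [v vE] := eltV w wV.
  have vF : val v \notin val F by apply/negP => /set_mem; rewrite vE.
  have vp : v != p by apply: contraNneq vF => ->; rewrite -gp.
  by exists v => //; apply: connect1; rewrite e0E.
suff /connectP[q eq yE] : connect e0 x y.
  exists q; split=> //.
    by apply: sub_path eq => s t /= /andP[].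
  elim: q x {gx yE} eq => //= z q IH x /andP[/andP[_ /andP[_ gz]] eq].
  by rewrite gz (IH z).
apply: contrapT => Nxy; apply: no_sum.
pose C (w : 'rV[R]_d) := `[< exists2 v : vertexT P, val v = w & connect e0 x (inr v) >].
apply: (@disconnected_vertex_sum _ _ _ _ V PE VE fullP hp C).
- move=> G fG Gp; have [F FG] := fset_set_elt (finite_facets pP) fG.
  have gF : good (inl F) by rewrite gp FG; apply/mem_set.
  have nE w (v : vertexT P) : val v = w -> w != val p -> ~ G w -> e0 (inl F) (inr v).
    move=> vw wp Gw; rewrite e0E //; last by apply: contra_neq wp => <-.
    by apply/negP; rewrite vw FG => /set_mem.
  have [xF|xF] := boolP (connect e0 x (inl F)); [right|left] => w wV wp Cw.
    apply: contrapT => Gw; move/negP: Cw; apply; apply/asboolP.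
    have [v vw] := eltV w wV; exists v => //.
    by apply: connect_trans xF _; apply: connect1; apply: nE vw wp Gw.
  apply: contrapT => Gw; move/negP: xF; apply.
  have /asboolP[v vw xv] := Cw.
  apply: connect_trans xv _; rewrite e0_sym; apply: connect1; apply: nE vw wp Gw.
- have [v vp xv] := reach x gx; exists (val v); split.
  + exact: memV.
  + by apply: contra_neq vp; apply: val_inj.
  + by apply/asboolP; exists v.
- have [v vp yv] := reach y gy; exists (val v); split.
  + exact: memV.
  + by apply: contra_neq vp; apply: val_inj.
  + apply/negP => /asboolP[v' /val_inj -> xv]; apply: Nxy.
    by apply: connect_trans xv _; rewrite e0_sym.
Qed.

End Connectivity.

Theorem theorem3p16 (R : realType) (K : fieldType) (d : nat)
    (P : set 'rV[R]_d) (p : 'rV[R]_d)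
    (hP : polytope P) (hfull : full_dimensional P) (hp : vertex P p)
    (hsum : ~ comb_vertex_sum_at P p) :
  (toric_ideal K P `<=` slack_ideal K P ->
     toric_ideal K (vertex_split P p) `<=` slack_ideal K (vertex_split P p))
  /\ (graphic K P -> graphic K (vertex_split P p)).
Proof.
have [V [PE VE]] := polytope_vertices hP.
set Q := vertex_split P p.
have pQ : polytope Q by exists (split_gens p V); apply: vertex_splitE.
have QV : vertex Q = [set` split_gens p V] by apply: vertex_vertex_split.
have fullQ : full_dimensional Q by apply: (full_vertex_split PE).
have [p0 p0E] := fset_set_elt (finite_vertices hP) hp.
have memV (v : vertexT P) : val v \in V.
  by move: (val v) (vertexT_vertex hP v) => w; rewrite VE.
have mkF G : facet Q G -> exists F' : facetT Q, val F' = G.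
  exact: (fset_set_elt (finite_facets pQ)).
have mkV y : y \in split_gens p V -> exists v' : vertexT Q, val v' = y.
  by move=> yG; apply: (fset_set_elt (finite_vertices pQ)); rewrite QV.
have /choice[lift0 lift0E] (bF : bool * facetT P) :
    exists F' : facetT Q, val F' = lift_face P p bF.1 (val bF.2).
  by apply: mkF; apply: (lift_face_facet PE VE) => //; apply: facetT_facet.
have /choice[vx0 vx0E] (bv : bool * vertexT P) :
    exists v' : vertexT Q, val v' = split_point p bv.1 (val bv.2).
  by apply: mkV; apply/(split_gensP VE hp); exists bv.1, (val bv.2).
pose lift b F := lift0 (b, F); pose vx b v := vx0 (b, v).
have liftE b F : val (lift b F) = lift_face P p b (val F) := lift0E (b, F).
have vxE b v : val (vx b v) = split_point p b (val v) := vx0E (b, v).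
have [F1 fF1 F1p] := facet_avoiding PE VE hfull hp.
have [F0 F0E] := fset_set_elt (finite_facets hP) fF1.
have val_p v : v != p0 -> val v != p.
  by move=> vp; rewrite -p0E; apply: contra_neq vp; apply: val_inj.
have Eval (F : facetT P) : (slack_pattern F p0 = false) -> val F p.
  by rewrite slack_patternE // => /negbFE /set_mem; rewrite p0E.
have := @split_pattern K _ _ _ _ (@slack_pattern _ _ P) (@slack_pattern _ _ Q)
  lift vx p0.
have E'_same b F v : slack_pattern (lift b F) (vx b v) = slack_pattern F v.
  rewrite !slack_patternE // liftE vxE; congr (~~ _).
  have [E1 E2] := lift_face_same VE hp b (facetT_facet hP F).1 (memV v).
  by apply/idP/idP => /set_mem; [move=> /E1|move=> /E2] => Fv; apply/mem_set.
move=> /(_ E'_same).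
have lift_surj F' : exists b F, F' = lift b F.
  have [b [F [fF F'E]]] := split_facetP PE VE hfull hp (facetT_facet pQ F').
  have [F2 F2E] := fset_set_elt (finite_facets hP) fF.
  by exists b, F2; apply: val_inj; rewrite liftE F2E.
move=> /(_ lift_surj).
have vx_surj v' : exists b v, v' = vx b v.
  have : val v' \in split_gens p V by move: (val v') (vertexT_vertex pQ v') => w; rewrite QV.
  move=> /(split_gensP VE hp)[b [w [wV v'E]]].
  have [v vE] : exists v : vertexT P, val v = w.
    by apply: (fset_set_elt (finite_vertices hP)); rewrite VE.
  by exists b, v; apply: val_inj; rewrite vxE vE.
move=> /(_ vx_surj).
have vx_eq v : v != p0 -> vx true v = vx false v.
  by move=> /val_p vp; apply: val_inj; rewrite !vxE; apply: split_point_eq.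
move=> /(_ vx_eq).
have lift_eq F : ~~ slack_pattern F p0 -> lift true F = lift false F.
  move=> /negbTE/Eval Fp; apply: val_inj; rewrite !liftE.
  exact: (lift_face_indep VE hp _ _ (facetT_facet hP F).1).
move=> /(_ lift_eq).
have E'_opp b F : slack_pattern (lift b F) (vx (~~ b) p0) = false.
  rewrite slack_patternE // liftE vxE p0E; apply/negbF/mem_set.
  exact: (lift_face_opp VE hp).
move=> /(_ E'_opp).
have vx_neq v : vx true p0 <> vx false v.
  by move/(congr1 val); rewrite !vxE p0E => /split_point_inj[_ /(_ erefl)].
move=> /(_ vx_neq F0).
have EF0 : slack_pattern F0 p0.
  by rewrite slack_patternE // p0E F0E; apply/negP => /set_mem.
move=> /(_ EF0).
rewrite -p0E in hsum.
move=> /(_ (link_connected hP hfull hsum) (adim1 P).+1).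
(* The dimension rises by one, so the minors have size [d + 2] for [P] and [d + 3] for the split,
   matching the single bordering row and column. *)
have -> : (adim1 P).+2 = (adim1 Q).+1 by rewrite hfull fullQ addn1.
by rewrite -!slack_idealE -!toric_idealE.
Qed.
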